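(* Let $G$ be the Chevalley supergroup functor attached to $\mathfrak g$, $V$ (and an admissible lattice $M$ of $V$) over $k$. The functors $G_1^{\pm,<}:(\mathrm{salg})\to(\mathrm{sets})$ are representable: they are the functor of points of the superscheme $\mathbb A_k^{0|N_\pm}$, with $N_\pm=|\Delta_1^\pm|$. In particular they are sheaves, hence $G_1^{\pm,<}=\mathbf G_1^{\pm,<}$. Similarly, $G_1^<=\mathbf G_1^<\cong\mathbb A_k^{0|N}$ as superschemes, where $N=|\Delta_1|=N_++N_-$.
   Context: $\mathbb K$ is an algebraically closed field of characteristic $0$. A finite dimensional non-Abelian Lie superalgebra $\mathfrak g=\mathfrak g_0\oplus\mathfrak g_1$ over $\mathbb K$ is classical if it has no nontrivial homogeneous ideals and $\mathfrak g_1$ is completely reducible as a $\mathfrak g_0$-module; by Kac these are the simple Lie algebras and $A(m,n),B(m,n),C(n),D(m,n),F(4),G(3),D(2,1;a),P(n),Q(n)$ (Kac's notation), where $P(n)=\big\{\begin{pmatrix}A&B\\C&-A^t\end{pmatrix}: A\in\mathfrak{sl}(n+1),\,B^t=B,\,C^t=-C\big\}$. Standing assumption: $\mathfrak g$ is classical, not of type $A(1,1)$, $P(3)$, $Q(n)$, nor $D(2,1;a)$ with $a\notin\mathbb Z$. Roots. $\mathfrak h$ is a fixed Cartan subalgebra of $\mathfrak g_0$; $\mathfrak g_\alpha=\{x\in\mathfrak g: [h,x]=\alpha(h)x\ \forall h\in\mathfrak h\}$; $\Delta_0=\{\alpha\ne0:\mathfrak g_\alpha\cap\mathfrak g_0\neq0\}$,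 $\Delta_1=\{\alpha:\mathfrak g_\alpha\cap\mathfrak g_1\ne0\}$, $\Delta=\Delta_0\cup\Delta_1$; $\ell=\dim\mathfrak h$. On $\mathfrak h$ and $\mathfrak h^*$ one has a nondegenerate symmetric form $(\ ,\ )$: the restriction of an even nondegenerate invariant form on $\mathfrak g$ if $\mathfrak g$ is not of type $P(n)$, and the one coming from $\mathfrak g_0\cong\mathfrak{sl}(n+1)$ for $P(n)$. Fix a distinguished simple root system $\Pi$ (all its elements even except one, if $\mathfrak g_1\neq0$; every root is a sum of elements of $\Pi$, ''positive'', or the opposite of such a sum, ''negative''); $\Delta^\pm$ are the positive/negative roots, $\Delta_i^\pm=\Delta^\pm\cap\Delta_i$. Coroots. If $\mathfrak g$ is not of type $P(n)$, $H_\alpha\in\mathfrak h$ is proportional to the element dual to $\alpha$ under the form, normalized by $\alpha(H_\alpha)=2$ if $(\alpha,\alpha)\ne0$, and, if $(\alpha,\alpha)=0$, so that the numbers $\beta(H_\alpha)$ $(\beta\in\Delta)$ generate $\mathbb Z$ (unique up to an immaterial sign, with $H_{-\alpha}=-H_\alpha$). For $P(n)$, with $\varepsilon_i$ the diagonal coordinates, the even roots are $\alpha_{i,j}=\varepsilon_i-\varepsilon_j$ with usual coroots, the odd ones are $\pm\beta_{i,j}$, $\beta_{i,j}=\beta_{j,i}=\varepsilon_i+\varepsilon_j$ $(i<j)$, and $\gamma_i=2\varepsilon_i$; the positive odd roots are the $\beta_{i,j}$ and $\gamma_i$; $H_{\pm\beta_{i,j}}:=\pm H_{\alpha_{i,j}}$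 $(i<j)$; sums and strings of roots of $P(n)$ are computed formally in the free $\mathbb Z$-module on $\varepsilon_1,\dots,\varepsilon_{n+1}$. The $\alpha$-string through $\beta$ is $\{\beta-r\alpha,\dots,\beta+q\alpha\}$ with $r,q\geq0$ largest such that $\beta+j\alpha\in\Delta\cup\{0\}$ for $-r\le j\le q$. A Chevalley basis of $\mathfrak g$ is a homogeneous $\mathbb K$-basis $\{H_1,\dots,H_\ell\}\sqcup\{X_\alpha\}_{\alpha\in\Delta}$ such that: (a) $\{H_i\}$ is a $\mathbb K$-basis of $\mathfrak h$, and $\mathfrak h_{\mathbb Z}:=\mathrm{Span}_{\mathbb Z}(H_1,\dots,H_\ell)=\mathrm{Span}_{\mathbb Z}\{H_\alpha:\alpha\in\Delta\cap(-\Delta)\}$; (b) $[H_i,H_j]=0$, $[H_i,X_\alpha]=\alpha(H_i)X_\alpha$; (c) $[X_\alpha,X_{-\alpha}]=\sigma_\alpha H_\alpha$ for $\alpha\in\Delta\cap(-\Delta)$, with $\sigma_\alpha=-1$ if $\alpha\in\Delta_1^-$ and $\sigma_\alpha=1$ otherwise; (d) $[X_\alpha,X_\beta]=c_{\alpha,\beta}X_{\alpha+\beta}$ for $\alpha\ne-\beta$, where: if $\alpha+\beta\notin\Delta$, then $c_{\alpha,\beta}=0$, $X_{\alpha+\beta}:=0$; if $\alpha+\beta\in\Delta$ and $(\alpha,\alpha)\ne0$ or $(\beta,\beta)\neq0$, then $c_{\alpha,\beta}=\pm(r+1)$ with $r$ from the $\alpha$-string through $\beta$, except that $c_{\alpha,\beta}=\pm(r+2)$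 if $\mathfrak g=P(n)$, $\alpha=\beta_{j,i}$, $\beta=\alpha_{i,j}$; if $\alpha+\beta\in\Delta$ and $(\alpha,\alpha)=0=(\beta,\beta)$, then $c_{\alpha,\beta}=\pm\beta(H_\alpha)$. Fix a Chevalley basis. $K_{\mathbb Z}(\mathfrak g)$ is the unital $\mathbb Z$-subsuperalgebra of $U(\mathfrak g)$ generated by all $X_\alpha^{(n)}:=X_\alpha^n/n!$ $(\alpha\in\Delta_0)$, $X_\gamma$ $(\gamma\in\Delta_1)$, $\binom{H_i}{n}$, $n\in\mathbb N$. Module. $V$ is a faithful finite dimensional rational $\mathfrak g$-module, i.e. $V=\bigoplus_\mu V_\mu$ (weight spaces for $\mathfrak h$) and $\mu(H_i)\in\mathbb Z$ for all $i$ and all weights $\mu$ of $V$; $M$ is an admissible lattice of $V$, i.e. a $K_{\mathbb Z}(\mathfrak g)$-stable $\mathbb Z$-span of a $\mathbb K$-basis of $V$. Functors. $k$ is a commutative unital ring in which $2$ and $3$ are nonzero and not zero divisors; all $k$-modules are assumed without $2$- and $3$-torsion. $(\mathrm{salg})$ is the category of commutative $k$-superalgebras $A=A_0\oplus A_1$ ($xy=(-1)^{p(x)p(y)}yx$ on homogeneous elements) with parity preserving unital morphisms. Put $V_k=k\otimes_{\mathbb Z}M$, $V_k(A)=A\otimes_kV_k$, and let $\mathrm{GL}(V_k(A))$ be its group of parity preserving $A$-linear automorphisms. For $\gamma\in\Delta_1$, $\vartheta\in A_1$ put $x_\gamma(\vartheta)=1+\vartheta X_\gamma\in\mathrm{GL}(V_k(A))$.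 For fixed total orders on $\Delta_1^\pm$ with $\gamma_1\prec\cdots\prec\gamma_{N_\pm}$ the elements of $\Delta_1^\pm$, put $G_1^{\pm,<}(A)=\{\prod_{i=1}^{N_\pm}x_{\gamma_i}(\vartheta_i):\vartheta_i\in A_1\}$ (product in the given order); similarly, for a fixed total order $\gamma_1\prec\cdots\prec\gamma_N$ on $\Delta_1$, $G_1^<(A)=\{\prod_{i=1}^{N}x_{\gamma_i}(\vartheta_i):\vartheta_i\in A_1\}$. (These are subsets of $G(A)$, the group generated by all one-parameter supersubgroups and the torus attached to the Chevalley basis.) Boldface denotes sheafification for the Zariski topology (coverings of $A$: families $A\to A[f_i^{-1}]$ with $f_i\in A_0$ generating the unit ideal). $\mathbb A_k^{0|q}=\underline{\mathrm{Spec}}\,k[\xi_1,\dots,\xi_q]$ (Grassmann algebra on $q$ odd generators), so $\mathbb A_k^{0|q}(A)=A_1^{q}$ naturally. *)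

(* Defs.v *)
From HB Require Import structures.
From mathcomp Require Import all_boot all_order all_algebra.
From mathcomp Require Import boolp classical_sets.

Set Implicit Arguments.
Unset Strict Implicit.
Unset Printing Implicit Defensive.

Import GRing.Theory.
Local Open Scope ring_scope.

(* Parities are booleans ([false] = even, [true] = odd); they add by [(+)] and
   the sign (-1)^(p(x)p(y)) is [(-1) ^+ (i && j)]. *)

Inductive zspan (W : zmodType) (P : W -> Prop) : W -> Prop :=
| zspan0 : zspan P 0
| zspan_in w : P w -> zspan P w
| zspanB w1 w2 : zspan P w1 -> zspan P w2 -> zspan P (w1 - w2).

Record lieSuperalgebra (K : fieldType) := LieSuperalgebra {
  lsort :> vectType K;
  lbr : lsort -> lsort -> lsort;
  lpart : bool -> {vspace lsort};
  lbr_linl : forall y, linear (fun x => lbr x y);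
  lbr_linr : forall x, linear (lbr x);
  lpart_full : (lpart false + lpart true)%VS = fullv;
  lpart_cap : (lpart false :&: lpart true)%VS = 0%VS;
  lbr_part : forall i j x y, x \in lpart i -> y \in lpart j ->
    lbr x y \in lpart (i (+) j);
  lbr_skew : forall i j x y, x \in lpart i -> y \in lpart j ->
    lbr x y = - ((-1) ^+ (i && j) *: lbr y x);
  lbr_jacobi : forall i j x y z, x \in lpart i -> y \in lpart j ->
    lbr x (lbr y z) =
    lbr (lbr x y) z + (-1) ^+ (i && j) *: lbr y (lbr x z)
}.

Section Lie.
Variables (K : fieldType) (g : lieSuperalgebra K).
Local Notation "{[ x , y ]}" := (@lbr K g x y).

Definition homogeneous_ideal (J : {vspace g}) : Prop :=
  J = (J :&: lpart g false + J :&: lpart g true)%VS /\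
  forall x y, y \in J -> {[x, y]} \in J.

Definition g0_submodule (W : {vspace g}) : Prop :=
  (W <= lpart g true)%VS /\
  forall x y, x \in lpart g false -> y \in W -> {[x, y]} \in W.

Definition classical_type : Prop :=
  [/\ exists x y, {[x, y]} <> 0,
      forall J, homogeneous_ideal J -> J = 0%VS \/ J = fullv &
      forall W, g0_submodule W -> exists W', [/\ g0_submodule W',
        (W + W')%VS = lpart g true & (W :&: W')%VS = 0%VS]].

Definition brV (U W : {vspace g}) : {vspace g} :=
  <<[seq {[u, w]} | u <- vbasis U, w <- vbasis W]>>%VS.

Definition cartan_of_even (h : {vspace g}) : Prop :=
  [/\ (h <= lpart g false)%VS,
      (brV h h <= h)%VS,
      exists n, iter n (brV h) h = 0%VS &
      forall x, x \in lpart g false ->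
        (forall y, y \in h -> {[x, y]} \in h) -> x \in h].

Definition even_invariant_form (kap : g -> g -> K) : Prop :=
  (forall x, linear (kap x : g -> K^o)) /\
  (forall y, linear ((fun x => kap x y) : g -> K^o)) /\
  [/\ forall x y, x \in lpart g false -> y \in lpart g true ->
        kap x y = 0 /\ kap y x = 0,
      forall i j x y, x \in lpart g i -> y \in lpart g j ->
        kap x y = (-1) ^+ (i && j) * kap y x,
      forall x y z, kap {[x, y]} z = kap x {[y, z]} &
      forall x, (forall y, kap x y = 0) -> x = 0].

Definition gl_hom p q (i : bool) (x : 'M[K]_(p + q)) : Prop :=
  if i then ulsubmx x = 0 /\ drsubmx x = 0
  else ursubmx x = 0 /\ dlsubmx x = 0.

(* [f] induces an isomorphism of Lie superalgebras S / J -> g, where S is a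
   graded subalgebra of gl(p|q) and J a graded ideal of S. *)
Definition presents p q (S J : 'M[K]_(p + q) -> Prop)
    (f : {linear 'M[K]_(p + q) -> g}) : Prop :=
  [/\ forall i x, S x -> gl_hom i x -> f x \in lpart g i,
      forall i j x y, S x -> S y -> gl_hom i x -> gl_hom j y ->
        f (x *m y - (-1) ^+ (i && j) *: (y *m x)) = {[f x, f y]},
      forall z : g, exists2 x, S x & f x = z &
      forall x, S x -> (f x = 0 <-> J x)].

Definition typeA11 : Prop :=
  exists f, @presents 2 2 (fun x => \tr (ulsubmx x) = \tr (drsubmx x))
                          (fun x => is_scalar_mx x) f.

Definition typeQ (n : nat) : Prop :=
  exists f, @presents n.+1 n.+1
    (fun x => [/\ ulsubmx x = drsubmx x, ursubmx x = dlsubmx x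
                & \tr (ursubmx x) = 0])
    (fun x => is_scalar_mx x) f.

Definition Pset (n : nat) (x : 'M[K]_(n.+1 + n.+1)) : Prop :=
  [/\ \tr (ulsubmx x) = 0, drsubmx x = - (ulsubmx x)^T,
      (ursubmx x)^T = ursubmx x & (dlsubmx x)^T = - dlsubmx x].

Definition P_iso (n : nat) (f : {linear 'M[K]_(n.+1 + n.+1) -> g}) : Prop :=
  @presents n.+1 n.+1 (@Pset n) (fun x => x = 0) f.

Definition typeP (n : nat) : Prop := exists f, @P_iso n f.

Definition psi2 (x y : 'cV[K]_2) : K :=
  x 0 0 * y 1 0 - x 1 0 * y 0 0.

(* The element z |-> psi(y,z) x - psi(z,x) y of sl(2). *)
Definition psl2 (x y : 'cV[K]_2) : 'M[K]_2 :=
  \matrix_(i, j) (psi2 y (delta_mx j 0) * x i 0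
                  - psi2 (delta_mx j 0) x * y i 0).

(* g_0 = sl(2)^3 acts on g_1 = K^2 (x) K^2 (x) K^2; the odd bracket has the
   structure constants (s1, s2, s3) = (-(1 + a), 1, a). *)
Definition typeD21 (a : K) : Prop :=
  [/\ a <> 0, a <> -1 &
  exists (f : 'I_3 -> {linear 'M[K]_2 -> g})
         (u : 'cV[K]_2 -> 'cV[K]_2 -> 'cV[K]_2 -> g),
  (forall y z, linear (fun x => u x y z)) /\
  (forall x z, linear (fun y => u x y z)) /\
  (forall x y, linear (u x y)) /\
  let f1 := f (inord 0) in let f2 := f (inord 1) in let f3 := f (inord 2) in
  [/\ forall z, z \in lpart g false <-> exists A : 'I_3 -> 'M[K]_2,
        (forall i, \tr (A i) = 0) /\ z = \sum_i f i (A i),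
      forall A : 'I_3 -> 'M[K]_2, (forall i, \tr (A i) = 0) ->
        \sum_i f i (A i) = 0 -> forall i, A i = 0 &
      basis_of (lpart g true)
        [seq u (delta_mx t.1.1 0) (delta_mx t.1.2 0) (delta_mx t.2 0)
        | t : ('I_2 * 'I_2 * 'I_2)%type]] /\
  [/\ forall i A B, \tr A = 0 -> \tr B = 0 ->
        {[f i A, f i B]} = f i (A *m B - B *m A),
      forall i j A B, i != j -> \tr A = 0 -> \tr B = 0 ->
        {[f i A, f j B]} = 0,
      forall A x y z, \tr A = 0 ->
        [/\ {[f1 A, u x y z]} = u (A *m x) y z,
            {[f2 A, u x y z]} = u x (A *m y) z &
            {[f3 A, u x y z]} = u x y (A *m z)] &
      forall x y z x' y' z', {[u x y z, u x' y' z']} =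
        (- (1 + a) * psi2 y y' * psi2 z z') *: f1 (psl2 x x')
        + (psi2 x x' * psi2 z z') *: f2 (psl2 y y')
        + (a * psi2 x x' * psi2 y y') *: f3 (psl2 z z')]].

(* D(2,1;a) only depends on the orbit of a under a -> 1/a, a -> -1-a: g is
   excluded when no member of the orbit is an integer. *)
Definition standing_assumption : Prop :=
  [/\ classical_type, ~ typeA11, ~ typeP 3, forall n, ~ typeQ n &
      forall a, typeD21 a -> exists z : int, typeD21 z%:~R].

Variable h : {vspace g}.
Notation hdual := 'Hom(subvs_of h, K^o).

Definition in_weight (al : hdual) (x : g) : Prop :=
  forall y : subvs_of h, {[vsval y, x]} = (al y : K) *: x.

Definition has_weight (i : bool) (al : hdual) : Prop :=
  exists x, [/\ x != 0, x \in lpart g i & in_weight al x].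

Definition Pdiag (n : nat) (a : 'rV[K]_n.+1) : 'M[K]_(n.+1 + n.+1) :=
  block_mx (diag_mx a) 0 0 (- diag_mx a).

Definition P_coordinates n (f : {linear 'M[K]_(n.+1 + n.+1) -> g})
    (eps : 'I_n.+1 -> hdual) : Prop :=
  [/\ P_iso f,
      forall y, y \in h <-> exists2 a : 'rV[K]_n.+1, \sum_i a 0 i = 0 & y = f (Pdiag a) &
      forall (a : 'rV_n.+1) (y : subvs_of h), \sum_i a 0 i = 0 ->
        vsval y = f (Pdiag a) -> forall i, eps i y = a 0 i].

(* The ways in which roots enter the definition of a Chevalley basis, uniform
    in g: outside type P(n) roots are elements of h^*, for P(n) they are formal
    elements of the free Z-module on the epsilon_i. *)
Record rootDatum := RootDatum {
  rlat : zmodType;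
  rval : rlat -> hdual;
  rootp : bool -> rlat -> Prop;
  hform : subvs_of h -> subvs_of h -> K;
  coroots : (rlat -> subvs_of h) -> Prop;
  (* the pairs with structure constant +-(r+2) *)
  exceptional : rlat -> rlat -> Prop;
  (* the convention on positive odd roots of P(n) *)
  positivity : (rlat -> Prop) -> Prop
}.

Definition nonP_rootp (i : bool) (al : hdual) : Prop :=
  (~~ i -> al <> 0) /\ has_weight i al.

Definition dual_elt (form : subvs_of h -> subvs_of h -> K) (al : hdual) :
  subvs_of h := xget 0 (fun t => forall y, form t y = al y).

Definition nonP_coroot (kap : g -> g -> K) (al : hdual) (H : subvs_of h) :
    Prop :=
  let form (x y : subvs_of h) := kap (vsval x) (vsval y) in
  let t := dual_elt form al in
  [/\ exists c : K, H = c *: t,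
      form t t <> 0 -> al H = 2%:R &
      form t t = 0 -> forall c : K,
        zspan (fun d : K => exists be i, nonP_rootp i be /\ d = be H) c <->
        exists z : int, c = z%:~R].

Definition nonP_datum (kap : g -> g -> K) : rootDatum := {|
  rlat := hdual;
  rval := id;
  rootp := nonP_rootp;
  hform := fun x y => kap (vsval x) (vsval y);
  coroots := fun Hc => forall i al, nonP_rootp i al ->
    nonP_coroot kap al (Hc al) /\ Hc (- al) = - Hc al;
  exceptional := fun _ _ => False;
  positivity := fun _ => True
|}.

Definition Peps n (i : 'I_n.+1) : 'rV[int]_n.+1 := delta_mx 0 i.

Definition P_rootp n (par : bool) (e : 'rV[int]_n.+1) : Prop :=
  if par then
    (exists i j, e = Peps i + Peps j) \/
    (exists i j : 'I_n.+1, (i < j)%N /\ e = - (Peps i + Peps j))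
  else exists i j : 'I_n.+1, i <> j /\ e = Peps i - Peps j.

Definition P_datum n (f : {linear 'M[K]_(n.+1 + n.+1) -> g})
    (eps : 'I_n.+1 -> hdual) : rootDatum := {|
  rlat := 'rV[int]_n.+1;
  rval := fun e => \sum_i eps i *~ e 0 i;
  rootp := @P_rootp n;
  hform := fun x y => \sum_i (eps i x : K) * (eps i y : K);
  coroots := fun Hc =>
    (forall i j : 'I_n.+1, i <> j ->
       vsval (Hc (Peps i - Peps j)) =
       f (Pdiag (delta_mx 0 i - delta_mx 0 j))) /\
    (forall i j : 'I_n.+1, (i < j)%N ->
       Hc (Peps i + Peps j) = Hc (Peps i - Peps j) /\
       Hc (- (Peps i + Peps j)) = - Hc (Peps i - Peps j));
  exceptional := fun al be => exists i j : 'I_n.+1,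
    [/\ i <> j, al = Peps j + Peps i & be = Peps i - Peps j];
  positivity := fun pos => forall e, P_rootp true e ->
    (pos e <-> exists i j, e = Peps i + Peps j)
|}.

Inductive root_datum_of_type : rootDatum -> Prop :=
| datum_nonP (kap : g -> g -> K) :
    (forall n, ~ typeP n) -> even_invariant_form kap ->
    root_datum_of_type (nonP_datum kap)
| datum_P n (f : {linear 'M[K]_(n.+1 + n.+1) -> g})
    (eps : 'I_n.+1 -> hdual) :
    P_coordinates f eps -> root_datum_of_type (P_datum f eps).

Variable D : rootDatum.

Definition root (al : rlat D) : Prop :=
  rootp false al \/ rootp true al.

Definition rform (al be : rlat D) : K :=
  @hform D (dual_elt (@hform D) (rval al)) (dual_elt (@hform D) (rval be)).

Definition enumerates (s : seq (rlat D)) (P : rlat D -> Prop) : Prop :=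
  uniq s /\ forall al, al \in s <-> P al.

(* The al-string through be starts at be - r al. *)
Definition string_r (al be : rlat D) (r : nat) : Prop :=
  (forall j, (j <= r)%N -> root (be - al *+ j) \/ be - al *+ j = 0) /\
  ~ (root (be - al *+ r.+1) \/ be - al *+ r.+1 = 0).

Definition sum_of (P : rlat D -> Prop) (al : rlat D) : Prop :=
  exists s : seq (rlat D),
    [/\ s <> [::], forall be, be \in s -> P be & al = \sum_(be <- s) be].

Definition root_span (P : rlat D -> Prop) (x : g) : Prop :=
  exists2 s : seq g, forall y, y \in s -> exists2 al, P al & in_weight (rval al) y
  & x = \sum_(y <- s) y.

(* The positive and negative roots attached to a distinguished simple system.
   For A(n,n) the simple roots satisfy a linear relation with positive
   coefficients in h^*, so that positivity is not determined by being a sum of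
   simple roots: [pos] and [neg] are given along with [Pi], and required to be
   disjoint and to span subalgebras of g. *)
Definition distinguished_system (Pi pos neg : rlat D -> Prop) : Prop :=
  [/\ forall al, root al <-> pos al \/ neg al,
      forall al, pos al -> ~ neg al,
      forall al, pos al -> sum_of Pi al &
      forall al, neg al -> sum_of Pi (- al)] /\
  [/\ forall al, Pi al -> pos al,
      forall al, Pi al -> ~ sum_of (fun be => Pi be /\ be <> al) al,
      lpart g true <> 0%VS -> exists! al, Pi al /\ rootp true al,
      forall x y, root_span pos x -> root_span pos y -> root_span pos {[x, y]} &
      forall x y, root_span neg x -> root_span neg y -> root_span neg {[x, y]}] /\
  positivity pos.

Definition chevalley_basis (neg : rlat D -> Prop)
    (Hc : rlat D -> subvs_of h)
    (H : 'I_(\dim h) -> subvs_of h) (X : rlat D -> g) : Prop :=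
  [/\ forall i al, rootp i al -> X al \in lpart g i,
      exists2 s, enumerates s root &
        basis_of fullv ([seq vsval (H i) | i : 'I_(\dim h)]
                        ++ [seq X al | al <- s]),
      basis_of fullv [seq H i | i : 'I_(\dim h)] &
      forall y, zspan (fun z => exists i, z = H i) y <->
        zspan (fun z => exists al, [/\ root al, root (- al) & z = Hc al]) y] /\
  [/\ forall i j, {[vsval (H i), vsval (H j)]} = 0,
      forall i al, root al ->
        {[vsval (H i), X al]} = (rval al (H i) : K) *: X al,
      forall al, root al -> root (- al) ->
        {[X al, X (- al)]} =
        (if `[< neg al /\ rootp true al >] then -1 else 1) *: vsval (Hc al) &
      forall al be, root al -> root be -> al <> - be ->
        [/\ ~ root (al + be) -> {[X al, X be]} = 0,
            root (al + be) -> rform al al <> 0 \/ rform be be <> 0 ->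
              exists r (e : bool), string_r al be r /\
                {[X al, X be]} =
                ((-1) ^+ e * (r + (if `[< exceptional al be >] then 2 else 1))%:R)
                  *: X (al + be) &
            root (al + be) -> rform al al = 0 -> rform be be = 0 ->
              exists e : bool, {[X al, X be]} =
                ((-1) ^+ e * (rval be (Hc al) : K)) *: X (al + be)]].

Record gmodule := GModule {
  msort :> vectType K;
  mpart : bool -> {vspace msort};
  mact : g -> msort -> msort;
  mact_linl : forall v, linear (fun x => mact x v);
  mact_linr : forall x, linear (mact x);
  mpart_full : (mpart false + mpart true)%VS = fullv;
  mpart_cap : (mpart false :&: mpart true)%VS = 0%VS;
  mact_part : forall i j x v, x \in lpart g i -> v \in mpart j ->
    mact x v \in mpart (i (+) j);
  mact_br : forall i j x y v, x \in lpart g i -> y \in lpart g j ->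
    mact {[x, y]} v =
    mact x (mact y v) - (-1) ^+ (i && j) *: mact y (mact x v)
}.

Variable V : gmodule.

Definition faithful_module : Prop :=
  forall x, (forall v : V, mact x v = 0) -> x = 0.

Definition weight_vector (mu : hdual) (v : V) : Prop :=
  forall y : subvs_of h, mact (vsval y) v = (mu y : K) *: v.

Definition rational_module (H : 'I_(\dim h) -> subvs_of h) : Prop :=
  (forall v : V, exists2 s : seq V,
     forall w, w \in s -> exists mu, weight_vector mu w
     & v = \sum_(w <- s) w) /\
  (forall mu (v : V), v <> 0 -> weight_vector mu v ->
     forall i, exists z : int, mu (H i) = z%:~R).

(* The operators by which the elements of K_Z(g) act on V. *)
Inductive KZ_operator (H : 'I_(\dim h) -> subvs_of h) (X : rlat D -> g) :
    (V -> V) -> Prop :=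
| KZ_one : KZ_operator H X id
| KZ_sub u1 u2 : KZ_operator H X u1 -> KZ_operator H X u2 ->
    KZ_operator H X (fun v => u1 v - u2 v)
| KZ_mul u1 u2 : KZ_operator H X u1 -> KZ_operator H X u2 ->
    KZ_operator H X (u1 \o u2)
| KZ_even al n : rootp false al ->
    KZ_operator H X (fun v => (n`!%:R : K)^-1 *: iter n (mact (X al)) v)
| KZ_odd al : rootp true al -> KZ_operator H X (mact (X al))
| KZ_bin i n : KZ_operator H X (fun v => (n`!%:R : K)^-1 *:
    iteri n (fun j w => mact (vsval (H i)) w - j%:R *: w) v).

(* The lattice is the Z-span of [b]; it is compatible with the Z/2-grading of
   V, [p i] being the parity of the i-th basis vector. *)
Definition admissible_basis (H : 'I_(\dim h) -> subvs_of h) (X : rlat D -> g)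
    d (b : d.-tuple V) (p : 'I_d -> bool) : Prop :=
  [/\ basis_of fullv b,
      forall i, tnth b i \in mpart V (p i) &
      forall u v, KZ_operator H X u ->
        zspan (fun w => w \in b) v -> zspan (fun w => w \in b) (u v)].

(* The matrix of x acting on the lattice, in the basis [b]; its i-th row is the
   image of the i-th basis vector. *)
Definition lattice_mx d (b : d.-tuple V) (x : g) : 'M[int]_d :=
  \matrix_(i, j) xget 0 (fun z : int => coord b j (mact x (tnth b i)) = z%:~R).

End Lie.

(* The direct sum decomposition A = A_0 (+) A_1 is given by its projections.
   Absence of 2- and 3-torsion is part of the notion, the zero algebra is
   allowed. *)
Record salg (k : comNzRingType) := Salg {
  ssort :> pzRingType;
  sunit : {rmorphism k -> ssort};
  spr : bool -> ssort -> ssort;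
  spr_additive : forall i, zmod_morphism (spr i);
  spr_sum : forall x, x = spr false x + spr true x;
  spr_spr : forall i j x, spr i (spr j x) = if i == j then spr j x else 0;
  spr_unit : forall c, spr false (sunit c) = sunit c;
  spr_mul : forall i j x y, spr (i (+) j) (spr i x * spr j y) = spr i x * spr j y;
  spr_comm : forall i j x y,
    spr i x * spr j y = (-1) ^+ (i && j) * (spr j y * spr i x);
  salg_torsion2 : forall x : ssort, x *+ 2 = 0 -> x = 0;
  salg_torsion3 : forall x : ssort, x *+ 3 = 0 -> x = 0
}.

Definition shom_deg k (A : salg k) (i : bool) : {pred A} :=
  [pred x | spr i x == x].

Definition odd_part k (A : salg k) := {x : A | x \in @shom_deg k A true}.

Record smor k (A B : salg k) := Smor {
  sfun :> A -> B;
  sfun_zmod : zmod_morphism sfun;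
  sfun_monoid : monoid_morphism sfun;
  sfun_unit : forall c, sfun (sunit A c) = sunit B c;
  sfun_spr : forall i x, sfun (spr i x) = spr i (sfun x)
}.

HB.instance Definition _ k (A B : salg k) (f : smor A B) :=
  GRing.isZmodMorphism.Build A B (sfun f) (sfun_zmod f).
HB.instance Definition _ k (A B : salg k) (f : smor A B) :=
  GRing.isMonoidMorphism.Build A B (sfun f) (sfun_monoid f).

Lemma smor_ext k (A B : salg k) (f g : smor A B) :
  sfun f = sfun g -> f = g.
Proof.
case: f g => [f f1 f2 f3 f4] [g g1 g2 g3 g4] /= efg; subst g.
by congr Smor; apply: Prop_irrelevance.
Qed.

Definition smor_id k (A : salg k) : smor A A.
Proof. by exists id. Defined.

Definition smor_comp k (A B C : salg k) (g : smor B C) (f : smor A B) :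
  smor A C.
Proof.
exists (sfun g \o sfun f).
- by move=> x y /=; rewrite !rmorphB.
- by split=> [|x y] /=; rewrite ?rmorph1 ?rmorphM.
- by move=> c /=; rewrite !sfun_unit.
- by move=> i x /=; rewrite !sfun_spr.
Defined.

Section AdjoinOdd.
Variables (k : comNzRingType) (S : salg k).

Lemma sprB i (x y : S) : spr i (x - y) = spr i x - spr i y.
Proof. exact: spr_additive. Qed.
Lemma spr0 i : spr i (0 : S) = 0.
Proof. by rewrite -[X in spr i X](subrr 0) sprB subrr. Qed.
Lemma sprD i (x y : S) : spr i (x + y) = spr i x + spr i y.
Proof. by rewrite -[y in LHS]opprK sprB -[- y]sub0r sprB spr0 sub0r opprK. Qed.
Lemma sprM i (x y : S) :
  spr i (x * y) = spr i x * spr false y + spr (~~ i) x * spr true y.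
Proof.
rewrite {1}(spr_sum x) {1}(spr_sum y) mulrDl !mulrDr !sprD.
have E a b : spr i (spr a x * spr b y) =
    if i == a (+) b then spr a x * spr b y else 0.
  by rewrite -(spr_mul a b x y) spr_spr.
by rewrite !E; move: i {E} => [] /=; rewrite ?addr0 ?add0r // addrC.
Qed.

Definition sconj (x : S) : S := spr false x - spr true x.

Lemma sconjD x y : sconj (x + y) = sconj x + sconj y.
Proof. by rewrite /sconj !sprD opprD addrACA. Qed.
Lemma sconjM x y : sconj (x * y) = sconj x * sconj y.
Proof.
by rewrite /sconj !sprM /= mulrBl !mulrBr opprB opprD [- _ - _]addrC addrACA.
Qed.
Lemma sunit_pr i c : spr i (sunit S c) = if i then 0 else sunit S c.
Proof. by rewrite -{1}spr_unit spr_spr; case: i => //=; rewrite spr_unit. Qed.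
Lemma sconj_unit c : sconj (sunit S c) = sunit S c.
Proof. by rewrite /sconj !sunit_pr subr0. Qed.
Lemma sconj1 : sconj 1 = 1.
Proof. by rewrite -(rmorph1 (sunit S)) sconj_unit. Qed.

(* S[xi] = S (+) S xi for an odd variable xi; (a, b) stands for a + b xi. *)
Definition adjoin_odd_type : Type := (S * S)%type.
HB.instance Definition _ := GRing.Zmodule.on adjoin_odd_type.
Notation T := adjoin_odd_type.

Definition ao_one : T := (1, 0).
Definition ao_mul (x y : T) : T :=
  (x.1 * y.1, x.1 * y.2 + x.2 * sconj y.1).

Fact ao_mulA : associative ao_mul.
Proof.
move=> [a b] [c d] [e f]; rewrite /ao_mul /=; congr pair; first exact: mulrA.
by rewrite sconjM mulrDr (mulrDl (a * d)) !mulrA addrA.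
Qed.
Fact ao_mul1l : left_id ao_one ao_mul.
Proof. by case=> a b; rewrite /ao_mul /= !mul1r mul0r addr0. Qed.
Fact ao_mul1r : right_id ao_one ao_mul.
Proof. by case=> a b; rewrite /ao_mul /= sconj1 !mulr1 mulr0 add0r. Qed.
Fact ao_mulDl : left_distributive ao_mul +%R.
Proof.
move=> [a b] [c d] [e f]; rewrite /ao_mul /=; congr pair; rewrite !mulrDl //=.
by rewrite addrACA.
Qed.
Fact ao_mulDr : right_distributive ao_mul +%R.
Proof.
move=> [a b] [c d] [e f]; rewrite /ao_mul /=; congr pair; first exact: mulrDr.
by rewrite sconjD (mulrDr a) (mulrDr b (sconj c)) addrACA.
Qed.
HB.instance Definition _ := GRing.Zmodule_isPzRing.Build T
  ao_mulA ao_mul1l ao_mul1r ao_mulDl ao_mulDr.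

Definition ao_unit (c : k) : T := (sunit S c, 0).
Fact ao_unit_zmod : zmod_morphism ao_unit.
Proof. by move=> x y; rewrite /ao_unit rmorphB; congr pair; rewrite subr0. Qed.
Fact ao_unit_monoid : monoid_morphism ao_unit.
Proof.
split=> [|x y]; rewrite /ao_unit ?rmorph1 //.
by congr pair; rewrite /= ?rmorphM // mulr0 mul0r addr0.
Qed.
HB.instance Definition _ := GRing.isZmodMorphism.Build k T ao_unit ao_unit_zmod.
HB.instance Definition _ :=
  GRing.isMonoidMorphism.Build k T ao_unit ao_unit_monoid.

Definition ao_pr (i : bool) (x : T) : T := (spr i x.1, spr (~~ i) x.2).

Lemma sconj_pr i (x : S) : sconj (spr i x) = (-1) ^+ i * spr i x.
Proof.
rewrite /sconj !spr_spr; case: i => /=.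
  by rewrite sub0r expr1 mulN1r.
by rewrite subr0 expr0 mul1r.
Qed.

Lemma sprN i (x : S) : spr i (- x) = - spr i x.
Proof. by rewrite -sub0r sprB spr0 sub0r. Qed.

Lemma spr_sign i n (x : S) : spr i ((-1) ^+ n * x) = (-1) ^+ n * spr i x.
Proof. by elim: n => [|n IH]; rewrite ?mul1r // !exprS !mulN1r !mulNr sprN IH. Qed.

Lemma spr_mulE l i j (x y : S) : l = i (+) j ->
  spr l (spr i x * spr j y) = spr i x * spr j y.
Proof. by move->; apply: spr_mul. Qed.

Lemma mulr_signC n (x y : S) : x * ((-1) ^+ n * y) = (-1) ^+ n * (x * y).
Proof. by rewrite mulrA commr_sign mulrA. Qed.

Definition adjoin_odd : salg k.
Proof.
exists T (ao_unit : {rmorphism k -> T}) ao_pr.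
- by move=> i [a b] [c d]; rewrite /ao_pr /=; congr pair; rewrite /= sprB.
- move=> [a b]; rewrite /ao_pr /=; congr pair => /=; first exact: spr_sum.
  by rewrite addrC; exact: spr_sum.
- by move=> i j [a b]; rewrite /ao_pr /= !spr_spr; case: i j => [] [].
- by move=> c; rewrite /ao_pr /= spr_unit spr0.
- move=> i j [a b] [c d]; rewrite /ao_pr /=; congr pair; first exact: spr_mul.
  rewrite /= sprD sconj_pr mulr_signC spr_sign.
  by rewrite !spr_mulE //; case: i j => [] [].
- move=> i j [a b] [c d]; rewrite mulr_sign /ao_pr.
  have e a' b' c' d' : ((a', b') : T) * (c', d') = (a' * c', a' * d' + b' * sconj c').
    by [].
  rewrite !e !sconj_pr !mulr_signC (spr_comm i j a c) (spr_comm i (~~ j) a d).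
  rewrite (spr_comm (~~ i) j b c) !mulr_sign.
  by case: i j => [] [] /=; rewrite ?opprK; congr pair; rewrite /= ?opprD ?opprK addrC.
- by move=> [a b] /= [/salg_torsion2 -> /salg_torsion2 ->].
- by move=> [a b] /= [/salg_torsion3 -> /salg_torsion3 ->].
Defined.
End AdjoinOdd.

Definition good_base (k : comNzRingType) : Prop :=
  [/\ 2%:R <> 0 :> k, 3%:R <> 0 :> k,
      GRing.lreg (2%:R : k) & GRing.lreg (3%:R : k)].

Definition base_salg (k : comNzRingType) (hk : good_base k) : salg k.
Proof.
exists k (idfun : {rmorphism k -> k}) (fun i x => if i then 0 else x).
- by case=> x y; rewrite ?subr0.
- by move=> x; rewrite addr0.
- by case=> [] [].
- by [].
- by case=> [] [] x y; rewrite ?mulr0 ?mul0r.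
- by case=> [] [] x y; rewrite ?mulr0 ?mul0r ?mulr0 //= expr0 mul1r mulrC.
- move=> x; rewrite -mulr_natl => x2; case: hk => _ _ r2 _.
  by apply: r2; rewrite x2 mulr0.
- move=> x; rewrite -mulr_natl => x3; case: hk => _ _ _ r3.
  by apply: r3; rewrite x3 mulr0.
Defined.

Definition grassmann (k : comNzRingType) (hk : good_base k) (q : nat) : salg k :=
  iter q (@adjoin_odd k) (base_salg hk).

Record presheaf (k : comNzRingType) := Presheaf {
  pobj :> salg k -> Type;
  pmap : forall A B : salg k, smor A B -> pobj A -> pobj B;
  pmap_id : forall A x, pmap (smor_id A) x = x;
  pmap_comp : forall A B C (g : smor B C) (f : smor A B) x,
    pmap (smor_comp g f) x = pmap g (pmap f x)
}.

Record natural k (F G : presheaf k) := Natural {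
  ncomp :> forall A : salg k, F A -> G A;
  ncompP : forall (A B : salg k) (f : smor A B) x,
    ncomp (pmap f x) = pmap f (ncomp x)
}.

Definition natural_iso k (F G : presheaf k) (eta : natural F G) : Prop :=
  forall A : salg k, bijective (@ncomp k F G eta A).

Definition Spec k (R : salg k) : presheaf k.
Proof.
exists (fun A => smor R A) (fun A B f x => smor_comp f x).
- by move=> A x; apply: smor_ext.
- by move=> A B C g f x; apply: smor_ext.
Defined.

Definition affine_odd_space (k : comNzRingType) (hk : good_base k) (q : nat) :
  presheaf k := Spec (grassmann hk q).

(* [u] exhibits [B] as the ring of fractions of [A] at the powers of the even
   (hence central) element [f]. *)
Definition is_localization k (A B : salg k) (f : A) (u : smor A B) : Prop :=
  [/\ exists v, v * u f = 1 /\ u f * v = 1,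
      forall y, exists a n, y * u f ^+ n = u a &
      forall a, u a = 0 <-> exists n, a * f ^+ n = 0].

(* A covering A -> A[f_i^-1], with the double localizations A[(f_i f_j)^-1] on
   which the gluing conditions are expressed. *)
Record covering k (A : salg k) := Covering {
  cidx : Type;
  cfun : cidx -> A;
  cfun_even : forall i, cfun i \in @shom_deg k A false;
  cfun_unit : exists (s : seq cidx) (a : cidx -> A),
    \sum_(i <- s) a i * cfun i = 1;
  cloc : cidx -> salg k;
  cmap : forall i, smor A (cloc i);
  cmapP : forall i, is_localization (cfun i) (cmap i);
  cloc2 : cidx -> cidx -> salg k;
  cresl : forall i j, smor (cloc i) (cloc2 i j);
  cresr : forall i j, smor (cloc j) (cloc2 i j);
  cresE : forall i j,
    smor_comp (cresl i j) (cmap i) = smor_comp (cresr i j) (cmap j);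
  cloc2P : forall i j,
    is_localization (cfun i * cfun j) (smor_comp (cresl i j) (cmap i))
}.

Arguments cloc {k A} c _.
Arguments cmap {k A} c _.
Arguments cresl {k A} c _ _.
Arguments cresr {k A} c _ _.

Definition is_sheaf k (F : presheaf k) : Prop :=
  forall (A : salg k) (C : covering A) (s : forall i, F (cloc C i)),
    (forall i j, pmap (cresl C i j) (s i) = pmap (cresr C i j) (s j)) ->
    exists! x : F A, forall i, pmap (cmap C i) x = s i.

Definition is_sheafification k (F S : presheaf k) (eta : natural F S) : Prop :=
  is_sheaf S /\
  forall (T : presheaf k) (phi : natural F T), is_sheaf T ->
    (exists psi : natural S T, forall A x, psi A (eta A x) = phi A x) /\
    (forall psi psi' : natural S T,
       (forall A x, psi A (eta A x) = psi' A (eta A x)) ->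
       forall A x, psi A x = psi' A x).

Section OddPoints.
Variables (k : comNzRingType) (d : nat) (p : 'I_d -> bool).

(* V_k(A) is the free left A-module A^d on the basis of the lattice, the i-th
   basis vector having parity [p i]. Vectors are rows and an A-linear
   endomorphism is v |-> v *m P, so that composition reverses products. *)
Definition endo_comp (A : pzRingType) (P Q : 'M[A]_d) : 'M[A]_d := Q *m P.

Definition in_GL (A : salg k) (P : 'M[A]_d) : Prop :=
  (forall i j, P i j \in @shom_deg k A (p i (+) p j)) /\
  exists Q, endo_comp P Q = 1%:M /\ endo_comp Q P = 1%:M.

(* 1 + theta X, where X acts on the lattice by the integral matrix [m] *)
Definition x_one_param (A : salg k) (m : 'M[int]_d) (theta : A) : 'M[A]_d :=
  1%:M + theta *: map_mx (fun z : int => z%:~R) m.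

Definition ordered_product (A : salg k) (ms : seq 'M[int]_d)
    (theta : 'I_(size ms) -> odd_part A) : 'M[A]_d :=
  \big[@endo_comp A/1%:M]_(i < size ms)
    x_one_param (tnth (in_tuple ms) i) (val (theta i)).

Definition odd_points (ms : seq 'M[int]_d) (A : salg k) : Type :=
  {P : 'M[A]_d | in_GL P /\
     exists theta : 'I_(size ms) -> odd_part A, P = ordered_product theta}.

Lemma map_endo_comp (A B : salg k) (f : smor A B) (P Q : 'M[A]_d) :
  map_mx f (endo_comp P Q) = endo_comp (map_mx f P) (map_mx f Q).
Proof.
apply/matrixP=> i j; rewrite !mxE rmorph_sum; apply: eq_bigr => l _.
by rewrite !mxE rmorphM.
Qed.

Lemma map_endo1 (A B : salg k) (f : smor A B) :
  map_mx f (1%:M : 'M[A]_d) = 1%:M.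
Proof. by apply/matrixP=> i j; rewrite !mxE rmorphMn rmorph1. Qed.

Lemma smor_deg (A B : salg k) (f : smor A B) i x :
  x \in @shom_deg k A i -> f x \in @shom_deg k B i.
Proof. by rewrite !inE => /eqP {2}<-; rewrite sfun_spr. Qed.

Lemma map_odd_points (ms : seq 'M[int]_d) (A B : salg k) (f : smor A B)
    (P : 'M[A]_d) :
  (in_GL P /\ exists theta : 'I_(size ms) -> odd_part A,
     P = ordered_product theta) ->
  in_GL (map_mx f P) /\ exists theta : 'I_(size ms) -> odd_part B,
     map_mx f P = ordered_product theta.
Proof.
case=> -[Pdeg [Q [PQ QP]]] [theta Pdef]; split.
  split; first by move=> i j; rewrite mxE; apply: smor_deg.
  by exists (map_mx f Q); rewrite -!map_endo_comp PQ QP map_endo1.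
exists (fun i => exist (fun x => x \in @shom_deg k B true)
                   (f (val (theta i))) (smor_deg f (valP (theta i)))).
rewrite Pdef /ordered_product.
rewrite (big_morph (map_mx f) (@map_endo_comp A B f) (map_endo1 f)).
apply: eq_bigr => i _; apply/matrixP=> r c.
by rewrite !mxE rmorphD rmorphMn rmorph1 rmorphM rmorph_int.
Qed.

Definition odd_functor (ms : seq 'M[int]_d) : presheaf k.
Proof.
exists (odd_points ms)
  (fun (A B : salg k) (f : smor A B) (x : odd_points ms A) =>
     exist _ (map_mx f (sval x)) (map_odd_points f (svalP x))).
- move=> A [P hP]; apply: eq_exist => /=.
  by apply/matrixP=> i j; rewrite mxE.
- move=> A B C g f [P hP]; apply: eq_exist => /=.
  by apply/matrixP=> i j; rewrite !mxE.
Defined.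
End OddPoints.

(* For [s] the increasing list of a totally ordered set of odd roots, the
   functor A |-> { prod_i x_(gamma_i)(theta_i) : theta_i in A_1 }. *)
Definition G1 (K : fieldType) (g : lieSuperalgebra K) (h : {vspace g})
    (D : rootDatum h) (V : gmodule g) (k : comNzRingType) (X : rlat D -> g)
    d (b : d.-tuple V) (p : 'I_d -> bool) (s : seq (rlat D)) : presheaf k :=
  odd_functor k p [seq lattice_mx b (X al) | al <- s].

Definition represented_by_odd_space (k : comNzRingType) (hk : good_base k)
    (F : presheaf k) (q : nat) : Prop :=
  exists eta : natural (affine_odd_space hk q) F, natural_iso eta.

(* The canonical morphism from F to its sheafification is an isomorphism. *)
Definition equals_sheafification (k : comNzRingType) (F : presheaf k) : Prop :=
  forall (S : presheaf k) (eta : natural F S),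
    is_sheafification eta -> natural_iso eta.

(* Main.v *)
Require Import Defs.
From HB Require Import structures.
From mathcomp Require Import all_boot all_order all_algebra.
From mathcomp Require Import boolp zify.
From mathcomp Require classical_sets.
Import Order.TTheory GRing.Theory Num.Theory.
Local Open Scope ring_scope.

(* A product prod (1 + th_i X_i) with odd th_i determines the th_i as soon as the
   integral matrices of the X_i are linearly independent over every k-algebra
   without 2-torsion: comparing two products to first order gives the result up
   to higher order terms, which are removed by nilpotency. The functor is then
   A |-> A_1^N, and odd elements glue by a partition of unity.

   For the independence, let sum a_g X_g = 0. The binomials of the H_i preserve
   the lattice, so that the relation splits according to the weights of the
   roots. The bracket with X_-g then yields a_g H_g = 0; hence a_g kills mu(H_g)
   for all weights mu of V, thus also be(H_g) for all roots be. These numbers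
   include 2 or generate Z. In type P(n) distinct odd roots may have the same
   restriction to h, but they have different degree sum_i e_i, and the bracket
   with a suitable root vector still singles out one of them; for g = 2 eps_i,
   where - g is not a root, one uses -(eps_i + eps_j) and the even root
   eps_i - eps_j. *)

Set Implicit Arguments.
Unset Strict Implicit.
Unset Printing Implicit Defensive.

(** * Commutative superalgebras *)

Section SuperAlgebra.
Variables (k : comNzRingType) (A : salg k).

Lemma odd_anticomm (x y : A) : x \in @shom_deg k A true ->
  y \in @shom_deg k A true -> x * y = - (y * x).
Proof.
rewrite !inE => /eqP <- /eqP <-.
by rewrite (spr_comm true true) expr1 mulN1r.
Qed.

Lemma odd_sqr (x : A) : x \in @shom_deg k A true -> x * x = 0.
Proof.
move=> xodd; apply: salg_torsion2.
by rewrite mulr2n {2}(odd_anticomm xodd xodd) subrr.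
Qed.

Lemma even_comm (x y : A) : x \in @shom_deg k A false -> x * y = y * x.
Proof.
rewrite inE => /eqP <-; rewrite {1 2}(spr_sum y) mulrDl mulrDr.
by rewrite (spr_comm false false) (spr_comm false true) !expr0 !mul1r.
Qed.

Lemma odd_partB (x y : A) : x \in @shom_deg k A true ->
  y \in @shom_deg k A true -> x - y \in @shom_deg k A true.
Proof. by rewrite !inE sprB => /eqP -> /eqP ->. Qed.

Lemma mulr_intC (x : A) (m : int) : x * m%:~R = m%:~R * x.
Proof. exact: commr_int. Qed.

End SuperAlgebra.

Section Morphism.
Variables (k : comNzRingType) (A B : salg k) (f : smor A B).

Lemma smorB x y : f (x - y) = f x - f y. Proof. exact: sfun_zmod. Qed.
Lemma smorD x y : f (x + y) = f x + f y. Proof. exact: raddfD. Qed.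
Lemma smor0 : f 0 = 0. Proof. exact: raddf0. Qed.
Lemma smor1 : f 1 = 1. Proof. exact: (sfun_monoid f).1. Qed.
Lemma smorM x y : f (x * y) = f x * f y. Proof. exact: (sfun_monoid f).2. Qed.
Lemma smorX x n : f (x ^+ n) = f x ^+ n. Proof. exact: rmorphXn. Qed.

End Morphism.

(** * Gluing along Zariski coverings *)

Section Sheaf.
Variables (k : comNzRingType).

(* The family [n] of exponents is lowered one at a time, since f_j y satisfies
   the hypothesis with n_j decreased. *)
Lemma partition_of_unity (A : pzRingType) (m : nat) (a f : 'I_m -> A)
    (I : A -> Prop) (y : A) (n : 'I_m -> nat) :
  (forall i x, f i * x = x * f i) -> \sum_i a i * f i = 1 ->
  I 0 -> (forall x z, I x -> I z -> I (x + z)) ->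
  (forall x z, I x -> I (z * x)) ->
  (forall i, I (f i ^+ n i * y)) -> I y.
Proof.
move=> fC af1 I0 ID IM.
move: {2}(\sum_i n i)%N (leqnn (\sum_i n i)) => N.
elim: N n y => [|N IH] n y leN In.
  have n0 i : n i = 0%N.
    by apply/eqP; rewrite -leqn0 (leq_trans _ leN) // (bigD1 i) //= leq_addr.
  rewrite -[y]mul1r -af1 mulr_suml.
  elim/big_ind: _ => // i _; rewrite -mulrA; apply/IM; apply/IM.
  by have := In i; rewrite n0 expr0 mul1r.
rewrite -[y]mul1r -af1 mulr_suml.
elim/big_ind: _ => // j _; rewrite -mulrA; apply/IM.
case nj: (n j) => [|nj'].
  by apply/IM; have := In j; rewrite nj expr0 mul1r.
apply: (IH (fun i => if i == j then nj' else n i)).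
  rewrite -ltnS (leq_trans _ leN) // (bigD1 j) //= eqxx.
  rewrite [X in (_ < X)%N](bigD1 j) //= nj addSn ltnS leq_add2l.
  by apply: leq_sum => i /negPf ->.
move=> i; case: (eqVneq i j) => [->|_].
  by rewrite mulrA -exprSr -nj; apply: In.
have -> : f i ^+ n i * (f j * y) = f j * (f i ^+ n i * y).
  by rewrite !mulrA; congr (_ * _); apply/esym/commrX; rewrite /GRing.comm fC.
exact: IM.
Qed.

Lemma localization_cancel (A B : salg k) (f : A) (u : smor A B) (n : nat)
    (x : B) : is_localization f u -> x * u f ^+ n = 0 -> x = 0.
Proof.
case=> -[v [_ fv]] _ _; elim: n => [|n IH]; first by rewrite mulr1.
rewrite exprSr mulrA => xf; apply: IH.
by rewrite -[LHS]mulr1 -fv mulrA xf mul0r.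
Qed.

(** Replaces finitely many local exponents by a common one. *)
Lemma exponent_bound (m : nat) (P : 'I_m -> nat -> Prop) :
  (forall i n n', (n <= n')%N -> P i n -> P i n') ->
  (forall i, exists n, P i n) -> exists n, forall i, P i n.
Proof.
move=> Pmono /choice[n Pn]; exists (\max_i n i)%N => i.
exact: Pmono (leq_bigmax i) (Pn i).
Qed.

Section Covering.
Variables (A : salg k) (C : covering A).

Lemma covering_ord : exists (m : nat) (idx : 'I_m -> cidx C) (a : 'I_m -> A),
  \sum_i a i * cfun (idx i) = 1.
Proof.
have [s [a as1]] := cfun_unit C.
exists (size s), (tnth (in_tuple s)), (a \o tnth (in_tuple s)).
by rewrite -as1 [RHS]big_tnth.
Qed.

Lemma cfun_comm i n (x : A) : cfun (c:=C) i ^+ n * x = x * cfun (c:=C) i ^+ n.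
Proof. exact/esym/commrX/esym/even_comm/cfun_even. Qed.

Lemma smor_even_comm (B : salg k) (u : smor A B) i n (x : B) :
  u (cfun (c:=C) i) ^+ n * x = x * u (cfun (c:=C) i) ^+ n.
Proof. exact/esym/commrX/esym/even_comm/smor_deg/cfun_even. Qed.

(** The combinations of the N-th powers form a left ideal, into which [partition_of_unity] puts
    1. *)
Lemma covering_power_unit m (idx : 'I_m -> cidx C) (a : 'I_m -> A) N :
  \sum_i a i * cfun (idx i) = 1 ->
  exists b : 'I_m -> A, \sum_i b i * cfun (idx i) ^+ N = 1.
Proof.
move=> af1.
suff [b ->] : exists b : 'I_m -> A, 1 = \sum_i b i * cfun (idx i) ^+ N by exists b.
apply: (@partition_of_unity A m a (fun i => cfun (idx i))
  (fun x => exists b : 'I_m -> A, x = \sum_i b i * cfun (idx i) ^+ N) 1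
  (fun=> N)) => //.
- by move=> i x; apply: (cfun_comm _ 1).
- by exists (fun=> 0); rewrite big1 // => i _; rewrite mul0r.
- move=> x z [b ->] [c ->]; exists (fun i => b i + c i).
  by rewrite -big_split; apply: eq_bigr => i _; rewrite mulrDl.
- move=> x z [b ->]; exists (fun i => z * b i).
  by rewrite mulr_sumr; apply: eq_bigr => i _; rewrite mulrA.
move=> i; exists (fun j => if j == i then 1 else 0).
rewrite mulr1 (bigD1 i) //= eqxx mul1r big1 ?addr0 // => j /negPf ->.
by rewrite mul0r.
Qed.

Lemma covering_separated (B : salg k) (u : smor A B) (x : B) :
  (forall i, exists n, x * u (cfun (c:=C) i) ^+ n = 0) -> x = 0.
Proof.
move=> /choice[n xf0]; have [m [idx [a af1]]] := covering_ord.
apply: (@partition_of_unity B m (u \o a) (fun i => u (cfun (idx i)))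
  (fun x => x = 0) x (n \o idx)) => //.
- by move=> i z; apply: (smor_even_comm _ _ 1).
- by rewrite -(rmorph1 u) -af1 rmorph_sum; apply: eq_bigr => i _; rewrite rmorphM.
- by move=> ? ? -> ->; rewrite addr0.
- by move=> ? ? ->; rewrite mulr0.
by move=> i; rewrite smor_even_comm.
Qed.

Lemma covering_inj (x y : A) :
  (forall i, cmap C i x = cmap C i y) -> x = y.
Proof.
move=> xy; apply/eqP; rewrite -subr_eq0; apply/eqP.
apply: (@covering_separated A (smor_id A)) => i.
have [_ _ ker] := cmapP i; apply/ker.
by rewrite smorB xy subrr.
Qed.

(** The classical argument carries over because the f_j are even, hence central: the s_j on a finite
    subcover are written with a common exponent n in the denominator, the numerators are made
    compatible inside A, and a partition of unity by powers of the f_j combines them. *)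
Lemma covering_glue (s : forall i, cloc C i) :
  (forall i j, cresl C i j (s i) = cresr C i j (s j)) ->
  exists x, forall i, cmap C i x = s i.
Proof.
move=> compat; have [m [idx [a af1]]] := covering_ord.
pose f j := cfun (idx j).
have fC j n x : f j ^+ n * x = x * f j ^+ n by apply: cfun_comm.
have wf i j (z : A) : cresl C i j (cmap C i z) = cresr C i j (cmap C j z).
  exact: (congr1 (fun w : smor _ _ => w z) (cresE i j)).
have [n /choice[x sx]] : exists n, forall j, exists x,
    s (idx j) * cmap C (idx j) (f j) ^+ n = cmap C (idx j) x.
  apply: exponent_bound => [j n n' nn' [x sx]|j].
    exists (x * f j ^+ (n' - n)).
    by rewrite smorM smorX -sx -mulrA -exprD subnKC.
  have [_ frac _] := cmapP (idx j); have [x [n sx]] := frac (s (idx j)).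
  by exists n, x.
(* Agreement on the overlaps kills these cross differences after inverting f_j f_l, hence a power of
   f_j f_l kills them in A; p serves all pairs. *)
have [p xp] : exists p, forall j l,
    (x j * f l ^+ n - x l * f j ^+ n) * (f j * f l) ^+ p = 0.
  have mono (y z : A) q q' : (q <= q')%N -> y * z ^+ q = 0 -> y * z ^+ q' = 0.
    by move=> qq' y0; rewrite -(subnKC qq') exprD mulrA y0 mul0r.
  apply: exponent_bound => [j q q' qq' y0 l|j]; first exact: mono (y0 l).
  apply: exponent_bound => [l q q' qq'|l]; first exact: mono.
  have [_ _ ker] := cloc2P (idx j) (idx l); apply/ker => /=.
  have := congr1 (cresl C (idx j) (idx l)) (sx j).
  have := congr1 (cresr C (idx j) (idx l)) (sx l).
  rewrite !smorM !smorX -compat -!wf => e2 e1.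
  rewrite !smorB !smorM !smorX -e1 -e2 -!mulrA -!smorX -!smorM fC.
  by rewrite subrr.
have [b bf1] := covering_power_unit (n + p) af1.
(* The factor f_j^p absorbs that power: s_j is now the fraction y_j / f_j^(n+p), and the numerators
   are compatible in A itself. *)
pose y j := x j * f j ^+ p.
have fcomm j l q r : f j ^+ q * f l ^+ r = f l ^+ r * f j ^+ q by rewrite fC.
have ysym j l : y j * f l ^+ (n + p) = y l * f j ^+ (n + p).
  apply/eqP; rewrite -subr_eq0 -[X in _ == X](xp j l) mulrBl.
  rewrite exprMn_comm; last exact: (fC j 1).
  rewrite /y !exprD -!mulrA; apply/eqP; congr (x j * _ - x l * _).
    by rewrite !mulrA (fcomm j l p n).
  by rewrite (fC l p) !mulrA.
have xf l : (\sum_j b j * y j) * f l ^+ (n + p) = y l.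
  rewrite -[RHS]mul1r -bf1 !mulr_suml; apply: eq_bigr => j _.
  by rewrite -[LHS]mulrA ysym -fC mulrA.
exists (\sum_j b j * y j) => i.
have yl l : cmap C (idx l) (\sum_j b j * y j) = s (idx l).
  apply/eqP; rewrite -subr_eq0; apply/eqP.
  apply: (@localization_cancel _ _ _ _ (n + p) _ (cmapP (idx l))).
  rewrite mulrBl -smorX -smorM xf smorX exprD mulrA sx -smorX -smorM.
  exact: subrr.
apply/eqP; rewrite -subr_eq0; apply/eqP; set z := \sum_j _.
(* The index i may lie outside the finite subfamily. The difference vanishes on each overlap with
   that subfamily, so it is killed by powers of the f_j, which generate the unit ideal. *)
suff wz j : exists q, (cmap C i z - s i) * cmap C i (f j) ^+ q = 0.
  have [q zq] := choice wz.
  apply: (@partition_of_unity _ m (cmap C i \o a) (fun j => cmap C i (f j))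
    (fun x => x = 0) _ q) => //.
  - by move=> j t; apply: (smor_even_comm _ _ 1).
  - rewrite -(rmorph1 (cmap C i)) -af1 rmorph_sum.
    by apply: eq_bigr => j _; rewrite /= smorM.
  - by move=> ? ? -> ->; rewrite addr0.
  - by move=> ? ? ->; rewrite mulr0.
  by move=> j; rewrite /= smor_even_comm; apply: zq.
have [_ frac _] := cmapP i.
have [c [q cE]] := frac (cmap C i z - s i).
have [_ _ ker] := cloc2P i (idx j).
have /ker[r cr] : smor_comp (cresl C i (idx j)) (cmap C i) c = 0.
  by rewrite /= -cE smorM smorB wf yl -compat subrr mul0r.
exists r; apply: (@localization_cancel _ _ _ _ (q + r) _ (cmapP i)).
have := congr1 (cmap C i) cr.
rewrite smorM -cE smorX smorM raddf0 exprMn_comm; last first.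
  exact: (smor_even_comm _ i 1).
by move=> cr0; rewrite -mulrA smor_even_comm exprD -!mulrA -[RHS]cr0 -!mulrA.
Qed.

(** Morphisms commute with the parity projections, so the odd part of a gluing of odd elements is
    again a gluing. *)
Lemma covering_glue_odd (s : forall i, cloc C i) :
  (forall i, s i \in @shom_deg k _ true) ->
  (forall i j, cresl C i j (s i) = cresr C i j (s j)) ->
  exists2 x, x \in @shom_deg k A true & forall i, cmap C i x = s i.
Proof.
move=> sodd /covering_glue[x xs]; exists (spr true x).
  by rewrite inE spr_spr eqxx.
by move=> i; rewrite sfun_spr xs; apply/eqP/sodd.
Qed.

End Covering.

End Sheaf.

(** * Products of odd one-parameter elements *)

Section OddProducts.
Variables (k : comNzRingType) (d : nat).

(** Linear independence with coefficients in an abelian group, on which the integral entries act. *)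
Definition integrally_free (A : zmodType) (ms : seq 'M[int]_d) : Prop :=
  forall a : 'I_(size ms) -> A,
    (forall r c, \sum_i a i *~ (tnth (in_tuple ms) i) r c = 0) ->
    forall i, a i = 0.

Variables (A : salg k) (ms : seq 'M[int]_d).
Notation N := (size ms).
Notation M i := (tnth (in_tuple ms) i).

(** An arbitrary list of factors permits induction; the list of all indices gives
    [ordered_product]. *)
Definition odd_prod (r : seq 'I_N) (th : 'I_N -> A) : 'M[A]_d :=
  \big[@endo_comp d A/1%:M]_(i <- r) x_one_param (M i) (th i).

Lemma odd_prod_nil th x y : odd_prod [::] th x y = (x == y)%:R.
Proof. by rewrite /odd_prod big_nil mxE. Qed.

Lemma odd_prod_cons i r th x y :
  odd_prod (i :: r) th x y =
  odd_prod r th x y + \sum_l odd_prod r th x l * th i * (M i l y)%:~R.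
Proof.
rewrite /odd_prod big_cons /endo_comp mulmxDr mulmx1 mxE; congr (_ + _).
by rewrite mxE; apply: eq_bigr => l _; rewrite !mxE mulrA.
Qed.

Section Injectivity.
Variables (th th' : 'I_N -> A).
Hypotheses (thP : forall i, th i \in @shom_deg k A true)
           (th'P : forall i, th' i \in @shom_deg k A true).
Let del i := th i - th' i.
Let delP i : del i \in @shom_deg k A true.
Proof. exact: odd_partB. Qed.

(** Injectivity amounts to 1 being in this annihilator. It is reached from multiples that already
    kill many of the parameters. *)
Let ann_delta (a : A) := forall j, a * del j = 0.

Lemma ann_deltaD a c : ann_delta a -> ann_delta c -> ann_delta (a + c).
Proof. by move=> a0 c0 j; rewrite mulrDl a0 c0 addr0. Qed.

Lemma ann_delta_odd a t : t \in @shom_deg k A true ->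
  ann_delta a -> ann_delta (a * t).
Proof.
move=> todd a0 j.
by rewrite -mulrA (odd_anticomm todd (delP j)) mulrN mulrA a0 mul0r oppr0.
Qed.

Section Annihilator.
Variable a : A.
Hypotheses (ath : forall i, ann_delta (a * th i))
           (ath' : forall i, ann_delta (a * th' i)).

(** Every term of the product other than the identity ends in some th'_i, and a th'_i kills the
    differences. *)
Lemma odd_prod_ann r x y : ann_delta (a * (odd_prod r th' x y - (x == y)%:R)).
Proof.
elim: r x y => [|i r IH] x y.
  by move=> j; rewrite odd_prod_nil subrr mulr0 mul0r.
rewrite odd_prod_cons addrAC mulrDr; apply: ann_deltaD => // j.
rewrite mulr_sumr mulr_suml big1 // => l _.
rewrite mulr_intC [a * _]mulrA (mulr_intC a) -!mulrA (mulrA a).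
rewrite -[X in a * X](subrK (x == l)%:R) mulrDr mulrDl mulrA.
rewrite (ann_delta_odd (th'P i) (IH x l)) add0r.
by case: eqP => _; rewrite ?(mulr1, mulr0, mul0r) // (mulrA a) ath' mulr0.
Qed.

(** The comparison to first order. With P, P' the two partial products, P th_i - P' th'_i = (P - P')
    th_i + (P' - 1) del_i + del_i. After multiplication by a, the first term vanishes by induction
    and anticommutation, the second by [odd_prod_ann]. *)
Lemma odd_prod_sub r x y : a * (odd_prod r th x y - odd_prod r th' x y) =
  \sum_(i <- r) a * del i * (M i x y)%:~R.
Proof.
elim: r x y => [|i r IH] x y; first by rewrite !odd_prod_nil big_nil subrr mulr0.
rewrite !odd_prod_cons big_cons opprD addrACA mulrDr IH [LHS]addrC; congr (_ + _).
have step l : a * (odd_prod r th x l * th i - odd_prod r th' x l * th' i) =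
    (x == l)%:R * (a * del i).
  rewrite -(subrK (odd_prod r th' x l) (odd_prod r th x l)) mulrDl -addrA -mulrBr.
  rewrite mulrDr mulrA IH mulr_suml big1 ?add0r => [|j _].
    rewrite -/(del i) -[odd_prod r th' x l](subrK (x == l)%:R) mulrDl mulrDr.
    rewrite mulrA odd_prod_ann add0r.
    by case: eqP => _; rewrite ?(mul1r, mul0r, mulr0).
  rewrite -mulrA -mulr_intC mulrA -(mulrA a) (odd_anticomm (delP j) (thP i)).
  by rewrite mulrN mulrA ath oppr0 mul0r.
rewrite -sumrB mulr_sumr (bigD1 x) //= big1 ?addr0 => [|l /negPf lx].
  by rewrite -mulrBl mulrA step eqxx mul1r.
by rewrite -mulrBl mulrA step eq_sym lx !mul0r.
Qed.
End Annihilator.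

Hypothesis free : integrally_free A ms.
Hypothesis eq_prod : odd_prod (index_enum 'I_N) th = odd_prod (index_enum 'I_N) th'.

Lemma ann_delta_step a : (forall i, ann_delta (a * th i)) ->
  (forall i, ann_delta (a * th' i)) -> ann_delta a.
Proof.
move=> ath ath'; apply: free => r c.
have := odd_prod_sub ath ath' (index_enum 'I_N) r c.
rewrite eq_prod subrr mulr0 => /esym sum0; rewrite -[RHS]sum0.
by apply: eq_bigr => i _; rewrite mulrzr.
Qed.

(* Every generator that [a] does not kill yet is killed by [a] times itself, so
   the number of surviving generators decreases until [a * z] is [0] for all of
   them. *)
Lemma odd_prod_inj : th =1 th'.
Proof.
pose z (i : 'I_N + 'I_N) := match i with inl i => th i | inr i => th' i end.
have zP i : z i \in @shom_deg k A true by case: i.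
pose alive (a : A) := [pred i | a * z i != 0].
suff H n a : (#|alive a| <= n)%N -> ann_delta a.
  move=> i; apply/eqP; rewrite -subr_eq0 -[X in X == 0]mul1r.
  exact/eqP/(H _ _ (leqnn _)).
elim: n a => [|n IH] a ale.
  have az i : a * z i = 0.
    move: ale; rewrite leqn0 => /eqP/card0_eq/(_ i).
    by rewrite !inE => /negbFE/eqP.
  apply: ann_delta_step => i j.
    by rewrite (az (inl i)) mul0r.
  by rewrite (az (inr i)) mul0r.
suff az i : ann_delta (a * z i).
  by apply: ann_delta_step => i; [apply: (az (inl i)) | apply: (az (inr i))].
have [az0|azi] := eqVneq (a * z i) 0; first by move=> j; rewrite az0 mul0r.
apply: IH; rewrite -ltnS; apply: leq_trans ale; apply/proper_card/properP.
split; last by exists i; rewrite !inE // -mulrA odd_sqr // mulr0 eqxx.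
apply/subsetP => j; rewrite !inE; apply: contraNneq => az0.
by rewrite -mulrA (odd_anticomm (zP i) (zP j)) mulrN mulrA az0 mul0r oppr0.
Qed.
End Injectivity.

End OddProducts.

(** * Parity and invertibility of the factors *)

Section GeneralLinear.
Variables (k : comNzRingType) (d : nat) (p : 'I_d -> bool) (A : salg k).

Definition odd_mx (m : 'M[int]_d) : Prop :=
  forall r c, ~~ (p r (+) p c) -> m r c = 0.

Lemma shom_degD i (x y : A) : x \in @shom_deg k A i -> y \in @shom_deg k A i ->
  x + y \in @shom_deg k A i.
Proof. by rewrite !inE sprD => /eqP -> /eqP ->. Qed.

Lemma shom_deg0 i : 0 \in @shom_deg k A i.
Proof. by rewrite inE spr0. Qed.

Lemma shom_degM i j (x y : A) : x \in @shom_deg k A i ->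
  y \in @shom_deg k A j -> x * y \in @shom_deg k A (i (+) j).
Proof. by rewrite !inE => /eqP <- /eqP <-; rewrite spr_mul. Qed.

Lemma shom_deg_int (z : int) : z%:~R \in @shom_deg k A false.
Proof. by rewrite inE -(rmorph_int (sunit A)) spr_unit. Qed.

Lemma in_GL1 : in_GL p (1%:M : 'M[A]_d).
Proof.
split=> [i j|]; last by exists 1%:M; rewrite /endo_comp mulmx1.
rewrite mxE; case: eqP => [->|_]; last exact: shom_deg0.
by rewrite addbb; apply: (shom_deg_int 1).
Qed.

Lemma in_GL_comp (P Q : 'M[A]_d) :
  in_GL p P -> in_GL p Q -> in_GL p (endo_comp P Q).
Proof.
move=> [Pdeg [P' [PP' P'P]]] [Qdeg [Q' [QQ' Q'Q]]]; split=> [i j|].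
  rewrite mxE; elim/big_ind: _ => [|x y|l _]; first exact: shom_deg0.
    exact: shom_degD.
  have -> : p i (+) p j = (p i (+) p l) (+) (p l (+) p j).
    by rewrite addbA -(addbA (p i)) addbb addbF.
  exact: shom_degM.
move: PP' P'P QQ' Q'Q; rewrite /endo_comp => PP' P'P QQ' Q'Q.
exists (P' *m Q').
by rewrite mulmxA -(mulmxA P') QQ' mulmx1 PP' mulmxA -(mulmxA Q) P'P mulmx1 Q'Q.
Qed.

(** The inverse is 1 - theta X: theta commutes with the integral entries of X, and theta^2 = 0
    removes the quadratic term. *)
Lemma in_GL_x_one_param (m : 'M[int]_d) (th : A) :
  odd_mx m -> th \in @shom_deg k A true -> in_GL p (x_one_param m th).
Proof.
move=> modd thodd; split=> [i j|].
  have [P1 _] := in_GL1; rewrite mxE; apply: shom_degD => //.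
  rewrite !mxE; case e: (p i (+) p j); last by rewrite modd ?e ?mulr0 ?shom_deg0.
  exact: (shom_degM thodd (shom_deg_int _)).
have sq (t : A) : t \in @shom_deg k A true ->
   (1%:M + t *: map_mx intr m) *m (1%:M - t *: map_mx intr m) = 1%:M.
  move=> todd; rewrite mulmxDl !mulmxBr !mulmx1 mul1mx subrKA -[RHS]subr0.
  congr (_ - _); apply/matrixP => i j; rewrite !mxE big1 // => l _.
  by rewrite !mxE mulrA -[t * _ * t]mulrA -mulr_intC mulrA odd_sqr // !mul0r.
have Nth : - th \in @shom_deg k A true.
  by rewrite -sub0r; apply: odd_partB => //; apply: shom_deg0.
exists (x_one_param m (- th)); rewrite /endo_comp /x_one_param.
by have := sq _ Nth; rewrite scaleNr opprK => ->; rewrite sq.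
Qed.
End GeneralLinear.

(** * Representability and the sheaf property *)

Section Grassmann.
Variables (k : comNzRingType).

Lemma odd_sconj (A : salg k) (t x : A) : t \in @shom_deg k A true ->
  t * x = sconj x * t.
Proof.
rewrite inE => /eqP <-; rewrite {1}(spr_sum x) mulrDr mulrBl.
by rewrite (spr_comm true false) (spr_comm true true) expr0 mul1r mulN1r.
Qed.

Section Adjoin.
Variables (S A : salg k).

Definition adjoin_incl : smor S (adjoin_odd S).
Proof.
exists (fun a => (a, 0) : adjoin_odd S).
- by move=> x y; congr pair; rewrite subr0.
- by split=> // x y; congr pair; rewrite /= mulr0 mul0r addr0.
- by [].
- by move=> i x; congr pair; rewrite spr0.
Defined.

Definition adjoin_gen : adjoin_odd S := (0, 1).

Lemma adjoin_gen_odd : adjoin_gen \in @shom_deg k _ true.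
Proof.
rewrite inE; apply/eqP; congr pair; first exact: spr0.
by have := spr_unit S 1; rewrite rmorph1.
Qed.

Lemma adjoin_decomp (x : adjoin_odd S) :
  x = adjoin_incl x.1 + adjoin_incl x.2 * adjoin_gen.
Proof.
case: x => a b; congr pair; first by rewrite /= mulr0 addr0.
by rewrite /= mulr1 mul0r addr0 add0r.
Qed.

(** Universal property of S[xi]: a + b xi goes to f a + f b t. Multiplicativity rests on t x =
    [sconj] x t and t^2 = 0. *)
Definition adjoin_ext (f : smor S A) (t : odd_part A) : smor (adjoin_odd S) A.
Proof.
exists (fun x => f x.1 + f x.2 * val t).
- by move=> x y /=; rewrite !smorB mulrBl opprD addrACA.
- split=> [|[a b] [c e]] /=; first by rewrite smor1 smor0 mul0r addr0.
  rewrite smorD !smorM /= -/(sconj c).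
  have -> : f (sconj c) = sconj (f c) by rewrite /sconj smorB !sfun_spr.
  have e0 : f b * val t * (f e * val t) = 0.
    by rewrite mulrA -(mulrA (f b)) (odd_sconj _ (valP t)) !mulrA -mulrA odd_sqr
      ?mulr0 //; apply: (valP t).
  rewrite [RHS]mulrDl (mulrDr (f a)) (mulrDr (f b * _)) e0 addr0 -[f b * _ * f c]mulrA.
  by rewrite (odd_sconj _ (valP t)) mulrDl !mulrA addrA.
- by move=> c /=; rewrite sfun_unit smor0 mul0r addr0.
- move=> i [a b] /=; rewrite sprD sprM !sfun_spr; congr (_ + _).
  have /eqP tE := valP t.
  have t0 : spr false (val t) = 0 by rewrite -tE spr_spr.
  by rewrite t0 tE mulr0 add0r.
Defined.

Lemma adjoin_ext_incl f t a : adjoin_ext f t (adjoin_incl a) = f a.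
Proof. by rewrite /= smor0 mul0r addr0. Qed.

Lemma adjoin_ext_gen f t : adjoin_ext f t adjoin_gen = val t.
Proof. by rewrite /= smor0 add0r smor1 mul1r. Qed.

Lemma adjoin_hom_ext (f f' : smor (adjoin_odd S) A) :
  smor_comp f adjoin_incl = smor_comp f' adjoin_incl ->
  f adjoin_gen = f' adjoin_gen -> f = f'.
Proof.
move=> e1 e2; apply: smor_ext; apply: funext => x.
have e (y : S) : f (adjoin_incl y) = f' (adjoin_incl y).
  exact: (congr1 (fun w : smor _ _ => w y) e1).
by rewrite (adjoin_decomp x) !smorD !smorM !e e2.
Qed.
End Adjoin.

Variable hk : good_base k.

Definition base_hom (A : salg k) : smor (base_salg hk) A.
Proof.
exists (fun c : k => sunit A c).
- by move=> x y; rewrite rmorphB.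
- by split=> [|x y]; rewrite ?rmorph1 ?rmorphM.
- by [].
- by case=> x; rewrite sunit_pr //= raddf0.
Defined.

Lemma base_hom_unique (A : salg k) (f : smor (base_salg hk) A) : f = base_hom A.
Proof. by apply: smor_ext; apply: funext => c; apply: (sfun_unit f c). Qed.

(* Otherwise unification unfolds the superalgebra structure. *)
Local Opaque adjoin_odd.

(** Index 0 is the variable adjoined last; the others come from the smaller Grassmann algebra. *)
Fixpoint grassmann_gen (q : nat) : 'I_q -> grassmann hk q :=
  match q return 'I_q -> grassmann hk q with
  | 0 => fun _ => 0
  | q'.+1 => fun i => if unlift ord0 i is Some j
                      then adjoin_incl _ (grassmann_gen j) else adjoin_gen _
  end.

Lemma grassmann_gen0 q :
  @grassmann_gen q.+1 ord0 = adjoin_gen (grassmann hk q).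
Proof. by rewrite /= unlift_none. Qed.

Lemma grassmann_genS q (j : 'I_q) :
  @grassmann_gen q.+1 (lift ord0 j) = adjoin_incl _ (grassmann_gen j).
Proof. by rewrite /= liftK. Qed.

Lemma grassmann_gen_odd q (i : 'I_q) : grassmann_gen i \in @shom_deg k _ true.
Proof.
elim: q i => [[]//|q IH] i; case: (unliftP ord0 i) => [j ->|->].
  by rewrite grassmann_genS; apply: (smor_deg (adjoin_incl _) (IH j)).
by rewrite grassmann_gen0; apply: adjoin_gen_odd.
Qed.

(** With [grassmann_hom_inj], this identifies the A-points of the odd affine space with q-tuples of
    odd elements. *)
Lemma grassmann_ext (A : salg k) q (th : 'I_q -> odd_part A) :
  exists f : smor (grassmann hk q) A, forall i, f (grassmann_gen i) = val (th i).
Proof.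
elim: q th => [|q IH] th; first by exists (base_hom A) => -[].
have [f fE] := IH (fun j => th (lift ord0 j)).
exists (adjoin_ext f (th ord0)) => i.
case: (unliftP ord0 i) => [j ->|->].
  by rewrite grassmann_genS adjoin_ext_incl.
by rewrite grassmann_gen0 adjoin_ext_gen.
Qed.

Lemma grassmann_hom_inj (A : salg k) q (f f' : smor (grassmann hk q) A) :
  (forall i, f (grassmann_gen i) = f' (grassmann_gen i)) -> f = f'.
Proof.
elim: q f f' => [|q IH] f f' ff'.
  by rewrite (base_hom_unique f) (base_hom_unique f').
suff H (g g' : smor (adjoin_odd (grassmann hk q)) A) :
    (forall i, g (@grassmann_gen q.+1 i) = g' (@grassmann_gen q.+1 i)) -> g = g'.
  exact: H.
move=> gg'; apply: adjoin_hom_ext; last by have := gg' ord0; rewrite grassmann_gen0.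
apply: IH => j; have := gg' (lift ord0 j).
by rewrite grassmann_genS.
Qed.
End Grassmann.

Section Representability.
Variables (k : comNzRingType) (d : nat) (p : 'I_d -> bool) (ms : seq 'M[int]_d).
Hypothesis ms_odd : forall i, odd_mx p (tnth (in_tuple ms) i).
Hypothesis ms_free : forall A : salg k, integrally_free A ms.
Notation N := (size ms).

Lemma ordered_product_inj (A : salg k) (th th' : 'I_N -> odd_part A) :
  ordered_product th = ordered_product th' -> th = th'.
Proof.
move=> e; apply: funext => i; apply: val_inj.
by apply: (odd_prod_inj (fun j => valP (th j)) (fun j => valP (th' j)) (@ms_free A) e).
Qed.

Lemma odd_pointP (A : salg k) (th : 'I_N -> odd_part A) :
  in_GL p (ordered_product th) /\
  exists th' : 'I_N -> odd_part A, ordered_product th = ordered_product th'.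
Proof.
split; last by exists th.
rewrite /ordered_product; elim/big_ind: _ => [|P Q|i _]; first exact: in_GL1.
  exact: in_GL_comp.
exact/in_GL_x_one_param/(valP (th i)).
Qed.

Definition odd_point (A : salg k) (th : 'I_N -> odd_part A) :
  odd_functor k p ms A := exist _ _ (odd_pointP th).

Lemma odd_point_inj A : injective (@odd_point A).
Proof. by move=> th th' /(congr1 sval) /ordered_product_inj. Qed.

Lemma odd_point_surj A (x : odd_functor k p ms A) : exists th, x = odd_point th.
Proof.
by case: x => P [PGL [th Pth]]; exists th; apply: eq_exist.
Qed.

Definition odd_part_map (A B : salg k) (f : smor A B) (x : odd_part A) :
  odd_part B := exist _ (f (val x)) (smor_deg f (valP x)).

Lemma pmap_odd_point (A B : salg k) (f : smor A B) (th : 'I_N -> odd_part A) :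
  Defs.pmap f (odd_point th) = odd_point (fun i => odd_part_map f (th i)).
Proof.
apply: eq_exist; rewrite /ordered_product.
rewrite (big_morph (map_mx f) (@map_endo_comp k d A B f) (map_endo1 d f)).
apply: eq_bigr => i _; apply/matrixP => r c.
by rewrite !mxE rmorphD rmorphMn rmorph1 rmorphM rmorph_int.
Qed.

(** A morphism goes to the product whose parameters are the images of the generators. It is
    recovered from the product, since the product determines its parameters. *)
Lemma odd_functor_represented (hk : good_base k) :
  represented_by_odd_space hk (odd_functor k p ms) N.
Proof.
pose gen i : odd_part (grassmann hk N) :=
  exist _ (grassmann_gen hk i) (grassmann_gen_odd hk i).
pose eta A (f : affine_odd_space hk N A) :=
  odd_point (fun i => odd_part_map f (gen i)).
have etaP A B (g : smor A B) f : eta B (Defs.pmap g f) = Defs.pmap g (eta A f).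
  rewrite pmap_odd_point; congr odd_point; apply: funext => i.
  exact: val_inj.
exists (Natural etaP) => A /=.
have /choice[inv invK] : forall x, exists f, eta A f = x.
  move=> x; have [th ->] := odd_point_surj x.
  have [f fE] := grassmann_ext hk th; exists f; congr odd_point.
  by apply: funext => i; apply: val_inj; rewrite /= fE.
have eta_inj : injective (eta A).
  move=> f f' /odd_point_inj ff'; apply: grassmann_hom_inj => i.
  exact: (congr1 (fun w => val (w i)) ff').
by exists inv => // f; apply: eta_inj; rewrite invK.
Qed.

(** Uniqueness of the parameters turns compatible points into compatible families of odd elements,
    which glue one parameter at a time. *)
Lemma odd_functor_sheaf : is_sheaf (odd_functor k p ms).
Proof.
move=> A C s compat.
pose th i := projT1 (cid (odd_point_surj (s i))).
have thE i : s i = odd_point (th i) by rewrite /th; case: cid.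
have th_compat i i' j : cresl C i i' (val (th i j)) = cresr C i i' (val (th i' j)).
  have := compat i i'; rewrite !thE !pmap_odd_point => /odd_point_inj e.
  exact: (congr1 (fun w => val (w j)) e).
have /choice[x xE] j : exists x : odd_part A, forall i, cmap C i (val x) = val (th i j).
  have [x xodd xE] := covering_glue_odd (fun i => valP (th i j))
    (fun i i' => th_compat i i' j).
  by exists (exist _ x xodd).
exists (odd_point x); split=> [i|y yE].
  rewrite pmap_odd_point thE; congr odd_point; apply: funext => j.
  exact/val_inj/xE.
have [t ty] := odd_point_surj y; rewrite ty; congr odd_point; apply: funext => j.
apply: val_inj; apply: (covering_inj (C := C)) => i; rewrite xE.
have := yE i; rewrite ty pmap_odd_point thE => /odd_point_inj e.
exact/esym/(congr1 (fun w => val (w j)) e).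
Qed.

End Representability.

Section Sheafification.
Variables (k : comNzRingType).

Definition natural_id (F : presheaf k) : natural F F :=
  @Natural k F F (fun A x => x) (fun A B f x => erefl).

Lemma natural_compP (F G H : presheaf k) (u : natural F G) (v : natural G H)
    (A B : salg k) (f : smor A B) x :
  v B (u B (Defs.pmap f x)) = Defs.pmap f (v A (u A x)).
Proof. by rewrite !ncompP. Qed.

Definition natural_comp F G H (u : natural F G) (v : natural G H) : natural F H :=
  Natural (natural_compP u v).

(** The identity of F factors through [eta], which yields a left inverse [psi]; uniqueness for S
    makes it a right inverse. *)
Lemma sheaf_equals_sheafification (F : presheaf k) :
  is_sheaf F -> equals_sheafification F.
Proof.
move=> Fsh S eta [Ssh univ] A.
have [[psi psiK] _] := univ F (natural_id F) Fsh.
have [_ uniq] := univ S eta Ssh.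
exists (psi A); first exact: psiK.
move=> x; apply: (uniq (natural_comp psi eta) (natural_id S)) => B y /=.
by congr (eta B _); apply: psiK.
Qed.
End Sheafification.

(** * Integral matrices *)

(* Binomial coefficients with an integral upper argument; Negz m is - (m + 1). *)
Definition binz (c : int) (n : nat) : int :=
  match c with
  | Posz m => 'C(m, n)%:Z
  | Negz m => (-1) ^+ n * 'C(m + n, n)%:Z
  end.

Lemma binz0 c : binz c 0 = 1.
Proof. by case: c => m; rewrite /= bin0 ?mulr1. Qed.

Lemma binz_succ c n : binz (c + 1) n.+1 = binz c n.+1 + binz c n.
Proof.
case: c => [m|[|m]].
- by rewrite -PoszD addn1 /= binS PoszD.
- by rewrite NegzE addNr /= !add0n !binn !mulr1 exprS mulN1r addNr.
have -> : Negz m.+1 + 1 = Negz m.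
  by rewrite !NegzE -(addn1 m.+1) PoszD opprD addrK.
rewrite /= !addSn !addnS (binS (m + n).+1) PoszD mulrDr exprS mulN1r.
rewrite !mulNr -addrA.
by rewrite addNr addr0.
Qed.

Lemma binz_rec c n : n.+1%:Z * binz c n.+1 = (c - n%:Z) * binz c n.
Proof.
case: c => m /=.
  rewrite -PoszM mul_bin_left.
  have [nm|mn] := leqP n m; first by rewrite PoszM subzn.
  by rewrite bin_small // muln0 mulr0.
rewrite mulrCA -PoszM addnS -mul_bin_diag /= NegzE exprS mulN1r PoszM.
by rewrite -opprD -PoszD addSn mulNr mulrCA mulNr.
Qed.

(** * Separation by binomial coefficients *)

Section Separation.
Variables (W : zmodType) (I : finType).

(** Induction on a bound for the c_i in the support of t. If all of them are at most K, the relation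
    for n = K involves only the terms with c_i = K; these are then discarded. *)
Lemma bin_separation (t : I -> W) (c : I -> nat) :
  (forall n, \sum_i t i *+ 'C(c i, n) = 0) ->
  forall z, \sum_(i | c i == z) t i = 0.
Proof.
have [K cK] : exists K, forall i, (c i < K)%N.
  by exists (\max_i c i).+1 => i; rewrite ltnS leq_bigmax.
have {cK} : forall i, (K <= c i)%N -> t i = 0 by move=> i; rewrite leqNgt cK.
elim: K t => [|K IH] t tK sum0 z; first by rewrite big1 // => i _; apply: tK.
have topP i : 'C(c i, K) = (c i == K) :> nat \/ t i = 0.
  by case: (ltngtP (c i) K) => [/bin_small|/tK|->]; [left|right|rewrite binn; left].
have top : \sum_(i | c i == K) t i = 0.
  rewrite -[RHS](sum0 K) [RHS](bigID (fun i => c i == K)) /= [X in _ + X]big1 ?addr0.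
    by apply: eq_bigr => i /eqP ->; rewrite binn.
  by move=> i /negPf ciK; case: (topP i) => ->; rewrite ?ciK ?mul0rn.
have [->//|zK] := eqVneq z K.
pose t' i := if c i == K then 0 else t i.
have -> : \sum_(i | c i == z) t i = \sum_(i | c i == z) t' i.
  by apply: eq_bigr => i /eqP ci; rewrite /t' ci (negPf zK).
apply: IH => [i|n].
  by rewrite /t' leq_eqVlt eq_sym; case: eqP => //= _; apply: tK.
rewrite -[RHS](sum0 n) (bigID (fun i => c i == K)) /= big1 ?add0r.
  rewrite [RHS](bigID (fun i => c i == K)) /= [X in X + _](_ : _ = 0) ?add0r.
    by apply: eq_bigr => i /negPf; rewrite /t' => ->.
  rewrite (eq_bigr (fun i => t i *+ 'C(K, n))) => [|i /eqP -> //].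
  by rewrite sumrMnl top mul0rn.
by move=> i ciK; rewrite /t' ciK mul0rn.
Qed.

(** By Pascal's rule the relations persist when all c_i are shifted by 1, so a shift by a large R
    reduces to natural numbers. *)
Lemma binz_separation (t : I -> W) (c : I -> int) :
  (forall n, \sum_i t i *~ binz (c i) n = 0) ->
  forall z, \sum_(i | c i == z) t i = 0.
Proof.
move=> sum0.
have shift (R n : nat) : \sum_i t i *~ binz (c i + R%:Z) n = 0.
  elim: R n => [|R IH] n; first by under eq_bigr do rewrite addr0; apply: sum0.
  case: n => [|n].
    by rewrite -[RHS](sum0 0%N); apply: eq_bigr => i _; rewrite !binz0.
  under eq_bigr do rewrite -addn1 PoszD addrA binz_succ mulrzDr.
  by rewrite big_split /= !IH addr0.
pose R := (\sum_i absz (c i))%N.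
have cR i : c i + R%:Z = (absz (c i + R%:Z))%:Z.
  rewrite gez0_abs // -lerBlDl sub0r; apply: le_trans (_ : `|c i| <= _).
    by rewrite -normrN ler_norm.
  by rewrite -abszE lez_nat /R (bigD1 i) //= leq_addr.
move=> z; have [[i /eqP ciz]|noz] := pselect (exists i, c i == z); last first.
  by rewrite big_pred0 // => i; apply/negP => ciz; apply: noz; exists i.
have := @bin_separation t (fun i => absz (c i + R%:Z)%R) _ (absz (z + R%:Z)%R).
rewrite (eq_bigl (fun j => c j == z)) => [|j]; last first.
  by rewrite -eqz_nat -!cR -ciz -cR (inj_eq (addIr _)).
by apply=> n; rewrite -[RHS](shift R n); apply: eq_bigr => j _; rewrite [in RHS]cR.
Qed.
End Separation.

Lemma mulrz_sumr (W : zmodType) (a : W) (I : Type) (r : seq I) (P : pred I)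
    (F : I -> int) :
  a *~ (\sum_(i <- r | P i) F i) = \sum_(i <- r | P i) a *~ F i.
Proof. exact: (big_morph _ (mulrzDr a) (mulr0z a)). Qed.

Lemma bezout_family (I : finType) (v : I -> int) :
  exists2 g, forall i, (g %| v i)%Z & exists c : I -> int, g = \sum_i c i * v i.
Proof.
suff [g gv gc] : exists2 g, forall i, i \in enum I -> (g %| v i)%Z &
    exists c : I -> int, g = \sum_i c i * v i.
  by exists g => // i; apply: gv; rewrite mem_enum.
elim: (enum I) => [|j r [g gv [c gE]]].
  by exists 0 => //; exists (fun=> 0); rewrite big1 // => i _; rewrite mul0r.
exists (gcdz (v j) g) => [i|].
  rewrite inE => /orP[/eqP ->|/gv]; first exact: dvdz_gcdl.
  exact/dvdz_trans/dvdz_gcdr.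
have [s [t <-]] := Bezoutz (v j) g.
exists (fun i => s * (i == j)%:R + t * c i).
rewrite gE mulr_sumr [s * _](_ : _ = \sum_i s * (i == j)%:R * v i).
  by rewrite -big_split; apply: eq_bigr => i _; rewrite /= [RHS]mulrDl !mulrA.
rewrite (bigD1 j) //= eqxx mulr1 big1 ?addr0 // => i /negPf ->.
by rewrite mulr0 mul0r.
Qed.

(* A primitive integral eigenvector v gives a * z * v = a * (v *m E) = 0, and
   the gcd of the entries of v is 1. *)
Lemma ann_eigenvalue (W : zmodType) (a : W) (d : nat) (E : 'M[int]_d) (z : int) :
  (forall r c, a *~ E r c = 0) -> \det (E - z%:M) = 0 -> a *~ z = 0.
Proof.
move=> aE /eqP/det0P[v v0 vE].
have {}vE : v *m E = z *: v.
  by apply/eqP; rewrite -subr_eq0 -mul_mx_scalar -mulmxBr vE.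
have [g gv [c gE]] := bezout_family (v ord0).
have g0 : g != 0.
  apply: contraNneq v0 => g0; apply/eqP/rowP => i; rewrite mxE.
  by have := gv i; rewrite g0 dvd0z => /eqP.
have [w vw] : exists w : 'rV[int]_d, v = g *: w.
  by exists (\row_i (v ord0 i %/ g)%Z); apply/rowP => i; rewrite !mxE mulrC divzK.
have wE : w *m E = z *: w.
  apply/rowP => i; apply: (mulfI g0).
  by have := congr1 (fun u : 'rV_d => u ord0 i) vE; rewrite vw -scalemxAl !mxE mulrCA.
have w1 : \sum_i c i * w ord0 i = 1.
  apply: (mulfI g0); rewrite mulr1 [RHS]gE mulr_sumr; apply: eq_bigr => i _.
  by rewrite [in RHS]vw mxE mulrCA.
have aw i : a *~ (z * w ord0 i) = 0.
  have := congr1 (fun u : 'rV_d => u ord0 i) wE; rewrite !mxE => <-.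
  rewrite mulrz_sumr; apply: big1 => j _.
  by rewrite mulrC mulrzA aE mul0rz.
rewrite -[z]mulr1 -w1 mulr_sumr mulrz_sumr; apply: big1 => i _.
by rewrite mulrCA mulrC mulrzA aw mul0rz.
Qed.

(** * The action of a Chevalley basis on an admissible lattice *)

Section CharZero.
Variables (K : fieldType) (charK : [pchar K] =i pred0).

Lemma intr_inj0 : injective (fun z : int => z%:~R : K).
Proof.
have nz n : n.+1%:R != 0 :> K by rewrite (pcharf0P K).1.
suff H (z : int) : z%:~R = 0 :> K -> z = 0.
  move=> x y /= xy; apply/eqP; rewrite -subr_eq0; apply/eqP/H.
  by rewrite rmorphB /= xy subrr.
case: z => [[|n]|n] //; first by move/eqP; rewrite -pmulrn (negPf (nz n)).
by rewrite NegzE => /eqP; rewrite rmorphN oppr_eq0 /= -pmulrn (negPf (nz n)).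
Qed.

(** Identities between integral matrices may thus be checked over K. *)
Lemma map_intr_inj m n :
  injective (fun M : 'M[int]_(m, n) => map_mx intr M : 'M[K]_(m, n)).
Proof.
move=> M N MN; apply/matrixP => i j; apply: intr_inj0.
by have := congr1 (fun M : 'M_(m, n) => M i j) MN; rewrite !mxE.
Qed.

End CharZero.

Section LinearProp.
Variables (K : fieldType) (U W : lmodType K) (f : U -> W) (f_lin : linear f).

Lemma linear_prop0 : f 0 = 0.
Proof. by have := f_lin (-1) 0 0; rewrite scaleN1r oppr0 addr0 scaleN1r addNr. Qed.

Lemma linear_propD x y : f (x + y) = f x + f y.
Proof. by have := f_lin 1 x y; rewrite !scale1r. Qed.

Lemma linear_propZ c x : f (c *: x) = c *: f x.
Proof. by have := f_lin c x 0; rewrite linear_prop0 !addr0. Qed.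

Lemma linear_prop_sum (I : Type) (r : seq I) (F : I -> U) :
  f (\sum_(i <- r) F i) = \sum_(i <- r) f (F i).
Proof. exact: (big_morph f linear_propD linear_prop0). Qed.
End LinearProp.

Lemma span_ind (K : fieldType) (U : vectType K) (X : seq U) (P : U -> Prop) :
  P 0 -> (forall c u v, P u -> P v -> P (c *: u + v)) ->
  (forall u, u \in X -> P u) -> forall u, u \in <<X>>%VS -> P u.
Proof.
move=> P0 Plin PX u; have -> : X = in_tuple X by [].
move=> /coord_span ->; elim/big_rec: _ => // i v _ Pv; apply/Plin => //.
exact/PX/mem_nth.
Qed.

Section Action.
Variables (K : fieldType).
Variables (g : lieSuperalgebra K) (V : gmodule g)
  (d : nat) (b : d.-tuple V) (b_basis : basis_of fullv b).
Notation "{[ x , y ]}" := (@lbr K g x y).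

(** Rows are the images of basis vectors, as in [lattice_mx], so composition reverses products. *)
Definition action_mx (u : V -> V) : 'M[K]_d :=
  \matrix_(i, j) coord b j (u (tnth b i)).
Notation rho x := (action_mx (mact x)).

Lemma action_mxE (u : V -> V) v j : linear u ->
  coord b j (u v) = \sum_i coord b i v * action_mx u i j.
Proof.
move=> ulin; rewrite {1}(coord_basis b_basis (memvf v)) (linear_prop_sum ulin) linear_sum.
apply: eq_bigr => i _; rewrite (linear_propZ ulin) linearZ mxE.
by rewrite (tnth_nth 0).
Qed.

Lemma action_mxM (u w : V -> V) : linear u ->
  action_mx (u \o w) = action_mx w *m action_mx u.
Proof.
move=> ulin; apply/matrixP => i j; rewrite !mxE /= action_mxE //.
by apply: eq_bigr => l _; rewrite [in RHS]mxE.
Qed.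

Lemma rho_br i j x y : x \in lpart g i -> y \in lpart g j ->
  rho {[x, y]} = rho y *m rho x - (-1) ^+ (i && j) *: (rho x *m rho y).
Proof.
move=> xi yj.
rewrite -(action_mxM _ (mact_linr x)) -(action_mxM _ (mact_linr y)).
by apply/matrixP => r c; rewrite !mxE (mact_br _ xi yj) linearB linearZ.
Qed.

Lemma rho_lin : linear (fun x : g => rho x).
Proof.
move=> c x y; apply/matrixP => i j; rewrite !mxE.
by rewrite (mact_linl (tnth b i)) linearD linearZ.
Qed.

Definition integral_mx (M : 'M[K]_d) : Prop :=
  forall i j, exists z : int, M i j = z%:~R.

Lemma zspan_coord v : zspan (fun w => w \in (b : seq V)) v ->
  forall j, exists z : int, coord b j v = z%:~R.
Proof.
elim=> [|w wb|w1 w2 _ IH1 _ IH2] j.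
- by exists 0; rewrite linear0.
- have /tnthP[i ->] := wb; exists (i == j)%:Z.
  rewrite (tnth_nth 0) coord_free; last exact: basis_free b_basis.
  by case: eqP.
have [z1 e1] := IH1 j; have [z2 e2] := IH2 j.
by exists (z1 - z2); rewrite linearB /= e1 e2 rmorphB.
Qed.

Lemma lattice_mxE x : integral_mx (rho x) ->
  map_mx intr (lattice_mx b x) = rho x.
Proof.
move=> xint; apply/matrixP => i j; rewrite !mxE.
have [z xz] := xint i j; rewrite mxE in xz.
by symmetry; exact: (classical_sets.xgetPex (T := int) 0
  (ex_intro (fun z : int => coord b j (mact x (tnth b i)) = z%:~R) z xz)).
Qed.
End Action.

(** * Binomials of an integral matrix and its eigenvalues *)

Section IntegralMatrices.
Variables (d : nat) (E : 'M[int]_d) (B : nat -> 'M[int]_d).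
Hypotheses (B0 : B 0%N = 1%:M)
  (BS : forall n, n.+1%:Z *: B n.+1 = B n *m (E - n%:Z%:M)).

(* B n stands for the binomial coefficient of E over n, and the identity is that
   of Vandermonde for E + c. *)
Lemma binomial_commute (m : 'M[int]_d) (c : int) :
  m *m E = (E + c%:M) *m m -> forall n,
  m *m B n = \sum_(j < n.+1) binz c j *: (B (n - j)%N *m m).
Proof.
move=> mE; elim=> [|n IH].
  by rewrite big_ord_recr big_ord0 /= subnn binz0 B0 mulmx1 mul1mx scale1r add0r.
have nz : n.+1%:Z != 0 by [].
apply/matrixP => r s; apply: (mulfI nz).
suff /matrixP/(_ r s) : n.+1%:Z *: (m *m B n.+1) =
   n.+1%:Z *: \sum_(j < n.+2) binz c j *: (B (n.+1 - j)%N *m m) by rewrite !mxE.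
rewrite scalemxAr BS mulmxA IH mulmx_suml.
(* Moving E past m turns E - n into (E - (n - j)) + (c - j), to which the recursions for B and
   [binz] apply. The two resulting sums recombine after a shift of j, since n + 1 = (n + 1 - j) +
   j. *)
have step (j : 'I_n.+1) :
    (binz c j *: (B (n - j)%N *m m)) *m (E - n%:Z%:M) =
    (n.+1 - j)%N%:Z *: (binz c j *: (B (n.+1 - j)%N *m m)) +
    j.+1%:Z *: (binz c j.+1 *: (B (n - j)%N *m m)).
  have jn : (j <= n)%N by rewrite -ltnS.
  rewrite -scalemxAl -mulmxA mulmxBr mE.
  have -> : (E + c%:M) *m m - m *m n%:Z%:M =
      (E - (n - j)%N%:Z%:M) *m m + (c - j%:Z) *: m.
    rewrite mulmxBl !mulmxDl !mul_scalar_mx mul_mx_scalar -!addrA.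
    congr (_ + _); rewrite -!scaleNr -!scalerDl -subzn // opprB.
    by congr (_ *: _); rewrite [RHS]addrC addrA subrK.
  rewrite mulmxDr mulmxA -BS -subSn // -!scalemxAl -scalemxAr scalerDr.
  by rewrite !scalerA binz_rec !(mulrC _ (binz c j)).
rewrite (eq_bigr _ (fun j _ => step j)) big_split /=.
pose Y j : 'M[int]_d := binz c j *: (B (n.+1 - j)%N *m m).
have split (j : 'I_n.+2) : n.+1%:Z *: (binz c j *: (B (n.+1 - j)%N *m m)) =
    (n.+1 - j)%N%:Z *: Y j + j%:Z *: Y j.
  by rewrite -scalerDl -PoszD subnK // -ltnS.
rewrite scaler_sumr (eq_bigr _ (fun j _ => split j)) big_split /=; congr (_ + _).
  by rewrite [RHS]big_ord_recr /= subnn scale0r addr0.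
rewrite [RHS]big_ord_recl scale0r add0r; apply: eq_bigr => j _.
by rewrite /Y lift0 subSS.
Qed.

Variables (W : zmodType) (I : finType) (m : I -> 'M[int]_d) (c : I -> int).
Hypothesis mE : forall i, m i *m E = (E + (c i)%:M) *m m i.

(* Multiplying the relation by B n gives the relations with coefficients
   a i * binz (c i) n for all n. *)
Lemma eigenvalue_separation (a : I -> W) :
  (forall r s, \sum_i a i *~ m i r s = 0) ->
  forall z r s, \sum_(i | c i == z) a i *~ m i r s = 0.
Proof.
move=> am0 z r s; apply: binz_separation => n.
pose T n r s := \sum_i a i *~ (binz (c i) n * m i r s).
suff {r s}T0 r s : T n r s = 0.
  rewrite -[RHS](T0 r s); apply: eq_bigr => i _.
  by rewrite mulrC mulrzA.
(* By the Vandermonde identity, the relation times B n is a combination of the T j with j at most n;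
   the lower ones vanish by induction, and T n occurs with B 0 = 1. *)
elim/ltn_ind: n r s => n IH r s.
have : \sum_l \sum_i a i *~ (m i r l * B n l s) = 0.
  rewrite big1 // => l _; under eq_bigr do rewrite mulrzA.
  by rewrite -mulrz_suml am0 mul0rz.
have expand i : \sum_l a i *~ (m i r l * B n l s) =
    \sum_(j < n.+1) \sum_l a i *~ (binz (c i) j * m i l s) *~ B (n - j)%N r l.
  have := congr1 (fun M : 'M_d => a i *~ M r s) (binomial_commute (mE i) n).
  rewrite !mxE mulrz_sumr => ->; rewrite summxE mulrz_sumr; apply: eq_bigr => j _.
  rewrite !mxE mulr_sumr mulrz_sumr; apply: eq_bigr => l _.
  by rewrite -mulrzA mulrCA mulrC.
rewrite exchange_big (eq_bigr _ (fun i _ => expand i)) exchange_big big_ord_recr /=.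
rewrite big1 ?add0r => [|j _]; last first.
  rewrite exchange_big big1 // => l _.
  by rewrite -mulrz_suml -/(T j l s) IH ?mul0rz.
rewrite subnn B0 => <-; apply: eq_bigr => i _.
rewrite (bigD1 r) //= mxE eqxx big1 ?addr0 // => l lr.
by rewrite mxE eq_sym (negPf lr).
Qed.

End IntegralMatrices.

(** The component of w along the basis vectors of the other parity has both parities, hence is 0. *)
Lemma coord_part (K : fieldType) (g : lieSuperalgebra K) (V : gmodule g) (d : nat)
    (b : d.-tuple V) (p : 'I_d -> bool) (i : bool) (w : V) (c : 'I_d) :
  basis_of fullv b -> (forall j, tnth b j \in mpart V (p j)) ->
  w \in mpart V i -> p c != i -> coord b c w = 0.
Proof.
move=> b_basis bp wi pc.
pose part j0 := \sum_(j | (p j == j0)) coord b j w *: tnth b j.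
have partP j0 : part j0 \in mpart V j0.
  by apply: memv_suml => j /eqP <-; apply/memvZ/bp.
have wE : w = part i + part (~~ i).
  rewrite {1}(coord_basis b_basis (memvf w)) (bigID (fun j => p j == i)) /=.
  congr (_ + _); apply: eq_big => [j|j _]; rewrite ?(tnth_nth 0) //.
  by case: (p j) i {wi pc} => [] [].
have p0 : part (~~ i) = 0.
  apply/eqP; rewrite -memv0 -(mpart_cap V).
  have pi : part (~~ i) \in mpart V i.
    by rewrite (_ : part _ = w - part i) ?rpredB // {1}wE addrC addKr.
  by rewrite memv_cap; case: i pi {wE wi pc} (partP (~~ i)) => /= -> ->.
have := congr1 (coord b c) p0; rewrite linear0 /part big_mkcond linear_sum /= => <-.
rewrite (bigD1 c) //= big1 ?addr0 => [|j /negPf jc].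
  case: ifP => [_|]; last by case: (p c) i pc {wi wE partP part p0} => [] [].
  by rewrite linearZ /= (tnth_nth 0) coord_free ?(basis_free b_basis) // eqxx /= mulr1.
case: ifP => _; last exact: linear0.
by rewrite linearZ /= (tnth_nth 0) coord_free ?(basis_free b_basis) // jc /= mulr0.
Qed.

(** * Root vectors and Cartan elements acting on the lattice *)

Section ChevalleyLattice.
Variables (K : fieldType) (charK : [pchar K] =i pred0).
Variables (g : lieSuperalgebra K) (h : {vspace g}).
Variables (D : rootDatum h) (neg : rlat D -> Prop) (Hc : rlat D -> subvs_of h).
Variables (H : 'I_(\dim h) -> subvs_of h) (X : rlat D -> g).
Hypothesis hHX : chevalley_basis neg Hc H X.
Hypothesis h_even : (h <= lpart g false)%VS.
Variables (V : gmodule g) (hV : faithful_module V) (hVr : rational_module V H).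
Variables (d : nat) (b : d.-tuple V) (p : 'I_d -> bool).
Hypothesis hM : admissible_basis H X b p.
Notation root := Defs.root.
Notation hdual := 'Hom(subvs_of h, K^o).
Notation "{[ x , y ]}" := (@lbr K g x y).
Notation rho x := (action_mx b (mact x)).

Let b_basis : basis_of fullv b. Proof. by case: hM. Qed.

Lemma root_vector_part i al : rootp i al -> X al \in lpart g i.
Proof. by case: hHX => -[+ _ _ _] _; apply. Qed.

Lemma rootP al : root al -> exists2 i, rootp i al & X al \in lpart g i.
Proof.
by case=> ral; [exists false | exists true] => //; apply: root_vector_part.
Qed.

Lemma root_vector_neq0 al : root al -> X al != 0.
Proof.
case: hHX => -[_ [s [_ sP] basis_s] _ _] _ /sP als.
have /basis_free := basis_s; move/free_not0; apply.
by rewrite mem_cat map_f ?orbT.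
Qed.

Lemma cartan_ind (P : subvs_of h -> Prop) :
  P 0 -> (forall c u v, P u -> P v -> P (c *: u + v)) ->
  (forall i, P (H i)) -> forall y, P y.
Proof.
move=> P0 Plin PH y; case: hHX => -[_ _ /span_basis spanH _] _.
apply: (@span_ind _ _ [seq H i | i : 'I_(\dim h)]) => //.
  by move=> u /mapP[i _ ->].
by rewrite spanH memvf.
Qed.

Lemma cartan_lfun_eq (mu nu : hdual) : (forall j, mu (H j) = nu (H j)) -> mu = nu.
Proof.
move=> e; apply/lfunP; elim/cartan_ind=> [|c u v eu ev|i]; last exact: e.
  by rewrite !linear0.
by rewrite !linearP /= eu ev.
Qed.

Lemma cartan_bracket al y : root al ->
  {[vsval y, X al]} = (rval al y : K) *: X al.
Proof.
move=> ral; elim/cartan_ind: y => [|c u v IHu IHv|i].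
- by rewrite linear0 (linear_prop0 (lbr_linl _)) linear0 scale0r.
- rewrite linearP (lbr_linl (X al)) IHu IHv linearP /=.
  by rewrite scalerDl scalerA.
by case: hHX => _ [_ + _ _]; apply.
Qed.

Lemma KZ_integral (u : V -> V) : KZ_operator H X u -> integral_mx (action_mx b u).
Proof.
move=> uKZ i j; case: hM => _ _ /(_ u (tnth b i) uKZ) ub.
have := zspan_coord b_basis (ub (zspan_in _)) j; rewrite mxE.
by apply; apply: mem_tnth.
Qed.

Lemma root_vector_integral al : root al -> integral_mx (rho (X al)).
Proof.
case=> ral; last exact/KZ_integral/KZ_odd.
have := KZ_integral (@KZ_even K g h D V H X al 1 ral).
by congr integral_mx; apply/matrixP => i j; rewrite !mxE /= invr1 scale1r.
Qed.

Lemma cartan_integral i : integral_mx (rho (vsval (H i))).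
Proof.
have := KZ_integral (@KZ_bin K g h D V H X i 1).
congr integral_mx; apply/matrixP => r s.
by rewrite !mxE /= invr1 scale1r scale0r subr0.
Qed.

Definition root_mx al := lattice_mx b (X al).
Definition cartan_mx i := lattice_mx b (vsval (H i)).

Lemma root_mxE al : root al -> map_mx intr (root_mx al) = rho (X al).
Proof. by move=> ral; apply/lattice_mxE/root_vector_integral. Qed.

Lemma cartan_mxE i : map_mx intr (cartan_mx i) = rho (vsval (H i)).
Proof. exact/lattice_mxE/cartan_integral. Qed.

(** B n is the matrix of the binomial of H_i over n, integral because the lattice is stable under
    it. *)
Lemma cartan_binomials i : exists B : nat -> 'M[int]_d, B 0%N = 1%:M /\
  forall n, n.+1%:Z *: B n.+1 = B n *m (cartan_mx i - n%:Z%:M).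
Proof.
pose u n v : V := iteri n (fun j w => mact (vsval (H i)) w - j%:R *: w) v.
have Bex n : exists M : 'M[int]_d,
    map_mx intr M = action_mx b (fun v => (n`!%:R : K)^-1 *: u n v).
  have int_n := KZ_integral (@KZ_bin K g h D V H X i n).
  exists (\matrix_(r, s) projT1 (cid (int_n r s))); apply/matrixP => r s.
  by rewrite !mxE; case: cid => z /= <-; rewrite mxE.
have [B BE] := choice Bex.
have nz n : n`!%:R != 0 :> K by rewrite (pcharf0P K).1 // -lt0n fact_gt0.
exists B; split=> [|n]; apply: (map_intr_inj charK); rewrite ?map_scalar_mx /=.
  rewrite BE; apply/matrixP => r s; rewrite !mxE /= invr1 scale1r (tnth_nth 0).
  by rewrite coord_free ?(basis_free b_basis) // rmorph1.
rewrite map_mxZ map_mxM map_mxB cartan_mxE !BE map_scalar_mx.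
have -> : rho (vsval (H i)) - (intr n%:Z)%:M =
    action_mx b (fun w => mact (vsval (H i)) w - n%:R *: w) :> 'M[K]_d.
  apply/matrixP => r s; rewrite !mxE linearB linearZ /= (tnth_nth 0).
  rewrite coord_free ?(basis_free b_basis) //; congr (_ - _).
  by rewrite mulr_natr.
rewrite -action_mxM //; last first.
  move=> c x y; rewrite mact_linr scalerDr scalerBr opprD addrACA.
  by rewrite !scalerA [n%:R * c]mulrC.
apply/matrixP => r s; rewrite !mxE -linearZ; congr (coord b s _).
rewrite /= (linear_propZ (mact_linr _)).
rewrite [n%:R *: (_ *: _)]scalerA [n%:R * _]mulrC -scalerA -scalerBr scalerA.
by congr (_ *: _); rewrite factS natrM invfM mulVKf // (pcharf0P K).1.
Qed.

Lemma cartan_root_mx i al c : root al -> rval al (H i) = c%:~R :> K ->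
  root_mx al *m cartan_mx i = (cartan_mx i + c%:M) *m root_mx al.
Proof.
move=> ral alc; have [j _ Xj] := rootP ral; apply: (map_intr_inj charK).
have Hi : vsval (H i) \in lpart g false by apply/(subvP h_even)/subvsP.
have := rho_br b_basis Hi Xj; rewrite cartan_bracket // alc.
rewrite (linear_propZ (rho_lin b)) /= expr0 scale1r -!root_mxE // -!cartan_mxE => e.
rewrite !map_mxM map_mxD map_scalar_mx mulmxDl mul_scalar_mx.
by rewrite [X in _ + X]e addrC subrK.
Qed.

Lemma weight_shift al (mu : hdual) (v : V) : root al -> weight_vector mu v ->
  weight_vector (mu + rval al) (mact (X al) v).
Proof.
move=> ral vmu y; have [i _ Xi] := rootP ral.
have hy : vsval y \in lpart g false by apply/(subvP h_even)/subvsP.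
have := mact_br v hy Xi; rewrite cartan_bracket // vmu.
rewrite (linear_propZ (mact_linl v)) (linear_propZ (mact_linr _)) scale1r.
by move=> e; rewrite lfunE /= scalerDl e addrC subrK.
Qed.

(** By faithfulness X_al moves some vector, hence some weight vector, as these span V. *)
Lemma root_acts al : root al ->
  exists (mu : hdual) (v : V), weight_vector mu v /\ mact (X al) v <> 0.
Proof.
move=> ral; apply: contrapT => no.
have /eqP := root_vector_neq0 ral; apply; apply: hV => v.
have [s sw ->] := hVr.1 v.
rewrite (linear_prop_sum (mact_linr _)) big_seq big1 // => w /sw[mu wmu].
by apply: contrapT => Xw; apply: no; exists mu, w.
Qed.

Definition integral_cartan : subvs_of h -> Prop :=
  zspan (fun z => exists i, z = H i).

Lemma weight_integral (mu : hdual) (v : V) y : v <> 0 -> weight_vector mu v ->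
  integral_cartan y -> exists z : int, mu y = z%:~R.
Proof.
move=> v0 vmu; elim=> [|_ [i ->]|y1 y2 _ [z1 e1] _ [z2 e2]].
- by exists 0; rewrite linear0.
- exact: hVr.2 v0 vmu i.
by exists (z1 - z2); rewrite linearB /= e1 e2 rmorphB.
Qed.

Section Annihilation.
Variables (W : zmodType) (a : W).

(** Includes the integrality of the action of x; the matrix C is unique in characteristic 0. *)
Definition annihilates (x : g) : Prop := exists2 C : 'M[int]_d,
  map_mx intr C = rho x & forall r s, a *~ C r s = 0.

Lemma annihilates_sign (e : bool) x :
  annihilates ((-1) ^+ e *: x) -> annihilates x.
Proof.
case=> C CE aC; exists ((-1) ^+ e *: C) => [|r s].
  rewrite map_mxZ CE (linear_propZ (rho_lin b)) scalerA rmorphXn rmorphN rmorph1.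
  by rewrite -expr2 sqrr_sign scale1r.
rewrite mxE mulr_sign; case: e {CE}; last exact: aC.
by rewrite mulrNz aC oppr0.
Qed.

Lemma annihilates_root al : root al ->
  annihilates (X al) <-> forall r s, a *~ root_mx al r s = 0.
Proof.
move=> ral; split=> [[C CE aC] r s|]; last by exists (root_mx al); rewrite ?root_mxE.
by rewrite (_ : root_mx al = C) //; apply: (map_intr_inj charK); rewrite CE root_mxE.
Qed.

(** The coordinates of v form an eigenvector of the integral matrix of y with eigenvalue mu(y), so
    [ann_eigenvalue] applies. *)
Lemma annihilates_weight (mu : hdual) (v : V) y : integral_cartan y ->
  annihilates (vsval y) -> v <> 0 -> weight_vector mu v ->
  exists2 z : int, mu y = z%:~R & a *~ z = 0.
Proof.
move=> yint [C CE aC] v0 vmu.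
have [z muz] := weight_integral v0 vmu yint; exists z => //.
apply: (ann_eigenvalue aC); apply: (intr_inj0 charK).
rewrite /= -det_map_mx map_mxB CE map_scalar_mx /= -muz.
apply/eqP/det0P; exists (\row_i coord b i v).
  apply: contra_notN v0 => /eqP/rowP x0.
  rewrite (coord_basis b_basis (memvf v)) big1 // => i _.
  by have := x0 i; rewrite !mxE => ->; rewrite scale0r.
apply/rowP => j; rewrite mulmxBr mul_mx_scalar !mxE.
have := action_mxE b_basis v j (mact_linr (vsval y)); rewrite vmu linearZ /= => ->.
by apply/eqP; rewrite subr_eq0; apply/eqP/eq_bigr => i _; rewrite mxE.
Qed.

(** A root is a difference of two weights of V, namely mu + al and mu with X_al nonzero on a vector
    of weight mu. *)
Lemma annihilates_cartan (al : rlat D) y : integral_cartan y -> annihilates (vsval y) ->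
  root al -> exists2 z : int, rval al y = z%:~R & a *~ z = 0.
Proof.
move=> yint ay ral; have [mu [v [vmu Xv]]] := root_acts ral.
have v0 : v <> 0 by move=> v0; apply: Xv; rewrite v0 (linear_prop0 (mact_linr _)).
have [z1 e1 a1] := annihilates_weight yint ay v0 vmu.
have [z2 e2 a2] := annihilates_weight yint ay Xv (weight_shift ral vmu).
exists (z2 - z1); last by rewrite mulrzBr a1 a2 subr0.
by rewrite rmorphB /= -e1 -e2 lfunE /= addrC addKr.
Qed.

Lemma annihilates_bracket al be : root al -> root be ->
  annihilates (X al) -> annihilates {[X al, X be]}.
Proof.
move=> ral rbe /(annihilates_root ral) a0.
have [i _ Xi] := rootP ral; have [j _ Xj] := rootP rbe.
exists (root_mx be *m root_mx al - (-1) ^+ (i && j) *: (root_mx al *m root_mx be)).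
  rewrite (rho_br b_basis Xi Xj) map_mxB map_mxZ !map_mxM !root_mxE //.
  by rewrite rmorphXn rmorphN rmorph1.
have a1 r s : a *~ (root_mx be *m root_mx al) r s = 0.
  by rewrite mxE mulrz_sumr big1 // => l _; rewrite mulrC mulrzA a0 mul0rz.
have a2 r s : a *~ (root_mx al *m root_mx be) r s = 0.
  by rewrite mxE mulrz_sumr big1 // => l _; rewrite mulrzA a0 mul0rz.
move: (root_mx be *m _) (root_mx al *m _) a1 a2 => A B a1 a2 r s.
rewrite !mxE mulr_sign mulrzBr a1 sub0r.
by case: (i && j); rewrite ?mulrNz a2 ?oppr0.
Qed.
End Annihilation.

Lemma root_integral (al : rlat D) i : root al -> exists c : int, rval al (H i) = c%:~R.
Proof.
move=> ral; have [mu [v [vmu Xv]]] := root_acts ral.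
have v0 : v <> 0 by move=> v0; apply: Xv; rewrite v0 (linear_prop0 (mact_linr _)).
have [z1 e1] := hVr.2 _ _ v0 vmu i.
have [z2 e2] := hVr.2 _ _ Xv (weight_shift ral vmu) i.
by exists (z2 - z1); rewrite rmorphB /= -e1 -e2 lfunE /= addrC addKr.
Qed.

(** One H_j is treated at a time; a' keeps the coefficients of the indices that agree with i0 on
    those already treated. *)
Lemma weight_separation (W : zmodType) (I : finType) (al : I -> rlat D)
    (a : I -> W) : (forall i, root (al i)) ->
  (forall r s, \sum_i a i *~ root_mx (al i) r s = 0) ->
  forall i0 r s,
  \sum_(i | [forall j, rval (al i) (H j) == rval (al i0) (H j)])
     a i *~ root_mx (al i) r s = 0.
Proof.
move=> ral am0 i0.
suff sep (js : seq 'I_(\dim h)) r s :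
    \sum_(i | all (fun j => rval (al i) (H j) == rval (al i0) (H j)) js)
      a i *~ root_mx (al i) r s = 0.
  move=> r s; rewrite -[RHS](sep (enum 'I_(\dim h)) r s); apply: eq_bigl => i.
  apply/forallP/allP => [e j _|e j]; first exact: e.
  by apply: e; rewrite mem_enum.
elim: js r s => [|j js IH] r s /=; first exact: am0.
pose a' i := if all (fun j => rval (al i) (H j) == rval (al i0) (H j)) js
             then a i else 0.
have /choice[c cE] i := root_integral j (ral i).
have [B [B0 BS]] := cartan_binomials j.
have a'0 r' s' : \sum_i a' i *~ root_mx (al i) r' s' = 0.
  rewrite -[RHS](IH r' s') [RHS]big_mkcond; apply: eq_bigr => i _.
  by rewrite /a'; case: ifP; rewrite ?mul0rz.
have := eigenvalue_separation B0 BS (fun i => cartan_root_mx (ral i) (cE i)) a'0.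
move=> /(_ (c i0) r s) e; rewrite -[RHS]e big_mkcond [RHS]big_mkcond.
apply: eq_bigr => i _; rewrite /a' !cE (inj_eq (intr_inj0 charK)).
by case: eqP => //= _; case: ifP; rewrite ?mul0rz.
Qed.

(* An odd root al is detected by be when the bracket with X_be singles X_al
   out among the odd root vectors of the same weight, and no torsion free
   coefficient kills the result. *)
Definition detected (al be : rlat D) : Prop :=
  [/\ rootp true be,
      forall ga, rootp true ga -> ga != al ->
        (forall j, rval ga (H j) = rval al (H j)) -> {[X ga, X be]} = 0 &
      forall (W : zmodType) (a : W), (forall x : W, x *+ 2 = 0 -> x = 0) ->
        annihilates a {[X al, X be]} -> a = 0].

(** Within the weight class of one root, the bracket with its detecting X_be removes all other
    terms, leaving a coefficient that annihilates a single bracket. *)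
Lemma root_mx_free (W : zmodType) (s : seq (rlat D)) :
  (forall x : W, x *+ 2 = 0 -> x = 0) -> uniq s ->
  (forall al, al \in s -> rootp true al /\ exists be, detected al be) ->
  integrally_free W [seq root_mx al | al <- s].
Proof.
move=> W2 s_uniq sP a am0.
pose al (i : 'I_(size [seq root_mx al | al <- s])) :=
  tnth (in_tuple s) (cast_ord (size_map _ _) i).
have alE i : tnth (in_tuple [seq root_mx al | al <- s]) i = root_mx (al i).
  rewrite /al !(tnth_nth 0) /=.
  by rewrite (nth_map 0) // -(size_map root_mx).
have al_inj : injective al.
  move=> i j; rewrite /al !(tnth_nth 0) /= => /eqP; rewrite nth_uniq //.
  - by move=> /eqP/val_inj.
  - by rewrite -(size_map root_mx).
  - by rewrite -(size_map root_mx).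
have al_in i : al i \in s by apply: mem_tnth.
have alr i : root (al i) by right; have [] := sP _ (al_in i).
move=> i0; have [_ [be [beodd be0 bedet]]] := sP _ (al_in i0).
have rbe : root be by right.
apply: bedet => //.
have am0' r c : \sum_i a i *~ root_mx (al i) r c = 0.
  by rewrite -[RHS](am0 r c); apply: eq_bigr => i _; rewrite alE.
have sep := weight_separation alr am0' i0.
(* Both root vectors are odd, so their bracket is the anticommutator. *)
pose C i := root_mx be *m root_mx (al i) + root_mx (al i) *m root_mx be.
have CE i : map_mx intr (C i) = rho {[X (al i), X be]}.
  have Xi : X (al i) \in lpart g true.
    by apply: root_vector_part; have [] := sP _ (al_in i).
  rewrite (rho_br b_basis Xi (root_vector_part beodd)) expr1 scaleN1r opprK.
  by rewrite map_mxD !map_mxM !root_mxE.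
exists (C i0) => // r c.
have Cz i : i != i0 -> [forall j, rval (al i) (H j) == rval (al i0) (H j)] -> C i = 0.
  move=> ii0 /forallP e; apply: (map_intr_inj charK); rewrite CE map_mx0.
  rewrite be0 ?(linear_prop0 (rho_lin b)) //.
  - by have [] := sP _ (al_in i).
  - by rewrite (inj_eq al_inj).
  - by move=> j; apply/eqP.
have : \sum_(i | [forall j, rval (al i) (H j) == rval (al i0) (H j)]) a i *~ C i r c = 0.
  under eq_bigr do rewrite !mxE mulrzDr !mulrz_sumr.
  rewrite big_split /= exchange_big [X in _ + X]exchange_big /=.
  rewrite !big1 ?addr0 // => l _.
    by under eq_bigr do rewrite mulrzA; rewrite -mulrz_suml sep mul0rz.
  by under eq_bigr do rewrite mulrC mulrzA; rewrite -mulrz_suml sep mul0rz.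
rewrite (bigD1 i0) /=; last by apply/forallP => j.
by rewrite big1 ?addr0 // => i /andP[e ii0]; rewrite Cz // mxE.
Qed.

Lemma root_mx_odd al : rootp true al -> odd_mx p (root_mx al).
Proof.
move=> ral r c prc; apply: (intr_inj0 charK); rewrite /= rmorph0.
have ral' : root al by right.
have := congr1 (fun M : 'M[K]_d => M r c) (root_mxE ral'); rewrite !mxE => ->.
have [_ bp _] := hM.
have Xb := mact_part (root_vector_part ral) (bp r).
apply: (coord_part b_basis bp Xb).
by move: prc; case: (p r) (p c) => [] [].
Qed.

Lemma coroot_integral al : root al -> root (- al) -> integral_cartan (Hc al).
Proof.
move=> ral rnal; case: hHX => -[_ _ _ spanE] _; apply/spanE/zspan_in.
by exists al.
Qed.

Lemma annihilates_coroot (W : zmodType) (a : W) al : root al -> root (- al) ->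
  annihilates a {[X al, X (- al)]} -> annihilates a (vsval (Hc al)).
Proof.
move=> ral rnal; case: hHX => _ [_ _ + _] => ->//.
by case: asboolP => _; [apply: (@annihilates_sign _ _ true)
  | apply: (@annihilates_sign _ _ false)].
Qed.

(* The form pairs X_al nontrivially with some X_be, and invariance forces the
   weights of the two to be opposite. *)
Lemma opposite_weight (kap : g -> g -> K) (al : rlat D) : even_invariant_form kap ->
  rootp true al ->
  exists2 be : rlat D, rootp true be & forall y, rval be y = - rval al y :> K.
Proof.
move=> [kap_linr [kap_linl [kap_par _ kap_inv kap_nd]]] al_odd.
have ral : root al by right.
apply: contrapT => no; have /eqP := root_vector_neq0 ral; apply; apply: kap_nd => y.
case: hHX => -[_ [s [_ sP] basis_s] _ _] _.
set basis := _ ++ _ in basis_s.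
apply: (@span_ind _ _ basis (fun y => kap (X al) y = 0) _ _ _ y); last first.
- by rewrite (span_basis basis_s) memvf.
- move=> u; rewrite mem_cat => /orP[/mapP[i _ ->]|/mapP[be bes ->]].
    have Hi : vsval (H i) \in lpart g false by apply/(subvP h_even)/subvsP.
    by have [] := kap_par _ _ Hi (root_vector_part al_odd).
  have /sP := bes => -[be_even|be_odd].
    by have [] := kap_par _ _ (root_vector_part be_even) (root_vector_part al_odd).
  apply: contrapT => /eqP kz; apply: no; exists be => // z.
  have rbe : root be by right.
  have hz : vsval z \in lpart g false by apply/(subvP h_even)/subvsP.
  (* Invariance gives - al(z) kap(X_al, X_be) = be(z) kap(X_al, X_be), and the pairing is
     nonzero. *)
  have := kap_inv (X al) (vsval z) (X be).
  rewrite (lbr_skew (root_vector_part al_odd) hz) scale1r !cartan_bracket //.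
  rewrite -scaleNr (linear_propZ (kap_linr _)) (linear_propZ (kap_linl _)) => e.
  by apply: (mulIf kz); symmetry.
- by move=> c u v u0 v0; rewrite (kap_linr (X al)) u0 v0 scaler0 addr0.
- exact: (linear_prop0 (kap_linr _)).
Qed.
End ChevalleyLattice.

(** * Detection of the odd roots *)

Section NonP.
Variables (K : fieldType) (charK : [pchar K] =i pred0).
Variables (g : lieSuperalgebra K) (h : {vspace g}) (kap : g -> g -> K).
Hypothesis kapP : even_invariant_form kap.
Notation D := (nonP_datum h kap).
Variables (neg : rlat D -> Prop) (Hc : rlat D -> subvs_of h).
Hypothesis hHc : coroots Hc.
Variables (H : 'I_(\dim h) -> subvs_of h) (X : rlat D -> g).
Hypothesis hHX : chevalley_basis neg Hc H X.
Hypothesis h_even : (h <= lpart g false)%VS.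
Variables (V : gmodule g) (hV : faithful_module V) (hVr : rational_module V H).
Variables (d : nat) (b : d.-tuple V) (p : 'I_d -> bool).
Hypothesis hM : admissible_basis H X b p.

Lemma nonP_detected (al : rlat D) : rootp true al ->
  exists be, detected H X b al be.
Proof.
move=> al_odd; have ral : Defs.root al by right.
have [be be_odd beE] := opposite_weight hHX h_even kapP al_odd.
(* Here a root is its weight, so the root of opposite weight is - al. *)
have {be beE be_odd} nal_odd : @rootp _ _ _ D true (- al).
  have <- // : be = - al :> rlat D.
  by apply/lfunP => y; rewrite lfunE /=; apply: beE.
have rnal : Defs.root (- al) by right.
exists (- al); split=> // [ga ga_odd gaal e|W a W2].
  by case/eqP: gaal; apply: (cartan_lfun_eq hHX).
move=> /(annihilates_coroot hHX ral rnal) aH.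
have Hint := coroot_integral hHX ral rnal.
have kill be := annihilates_cartan charK hHX h_even hV hVr hM Hint aH (al := be).
have [[_ nondeg isotropic] _] := hHc al_odd.
set form := fun x y : subvs_of h => kap (vsval x) (vsval y) in nondeg isotropic.
set t := dual_elt form al in nondeg isotropic.
(* If al is not isotropic, al(H_al) = 2, so that 2 kills a. *)
have [tt|/eqP tt] := eqVneq (form t t) 0; last first.
  have [z alz az] := kill _ ral; apply: W2.
  rewrite -[_ *+ 2]/(a *~ 2) (_ : 2 = z) //; apply: (intr_inj0 charK).
  by rewrite /= -alz; symmetry; apply: nondeg.
(* If al is isotropic, 1 is an integral combination of the values be(H_al), each of which kills
   a. *)
have /(isotropic tt) span1 : exists z : int, 1 = z%:~R :> K by exists 1.
have killz c : zspan (fun c : K => exists be i, nonP_rootp i be /\ c = be (Hc al)) c ->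
    exists2 z : int, c = z%:~R & a *~ z = 0.
  elim=> [|_ [be [i [be_root ->]]]|c1 c2 _ [z1 -> a1] _ [z2 -> a2]].
  - by exists 0.
  - have rbe : @Defs.root _ _ _ D be by case: i be_root; [right|left].
    by have [z e az] := kill be rbe; exists z.
  by exists (z1 - z2); rewrite ?rmorphB // mulrzBr a1 a2 subr0.
have [z z1 az] := killz _ span1.
by rewrite -[a]mulr1z (_ : 1 = z) //; apply: (intr_inj0 charK).
Qed.

End NonP.

Lemma lfun_mulz (K : fieldType) (U W : vectType K) (u : 'Hom(U, W)) (z : int) x :
  (u *~ z) x = u x *~ z.
Proof.
have mulrn m : (u *+ m) x = u x *+ m.
  by elim: m => [|m IH]; rewrite ?mulr0n ?mulrS lfunE //= IH.
by case: z => m; rewrite ?NegzE ?mulrNz -?pmulrn ?lfunE /= mulrn.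
Qed.

Lemma sum_delta (R : pzSemiRingType) (I : finType) (i : I) (F : I -> R) :
  \sum_l (l == i)%:R * F l = F i.
Proof.
rewrite (bigD1 i) //= eqxx mul1r big1 ?addr0 // => l /negPf ->.
by rewrite mul0r.
Qed.

(** * Type P(n) *)

Section TypeP.
Variables (K : fieldType) (charK : [pchar K] =i pred0).
Variables (g : lieSuperalgebra K) (h : {vspace g}) (n : nat).
Variables (f : {linear 'M[K]_(n.+1 + n.+1) -> g})
  (eps : 'I_n.+1 -> 'Hom(subvs_of h, K^o)).
Hypothesis fP : P_coordinates f eps.
Notation D := (P_datum f eps).
Variables (neg : rlat D -> Prop) (Hc : rlat D -> subvs_of h).
Hypothesis hHc : coroots Hc.
Variables (H : 'I_(\dim h) -> subvs_of h) (X : rlat D -> g).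
Hypothesis hHX : chevalley_basis neg Hc H X.
Hypothesis h_even : (h <= lpart g false)%VS.
Variables (V : gmodule g) (hV : faithful_module V) (hVr : rational_module V H).
Variables (d : nat) (b : d.-tuple V) (p : 'I_d -> bool).
Hypothesis hM : admissible_basis H X b p.
Notation "{[ x , y ]}" := (@lbr K g x y).
Notation root := (@Defs.root _ _ _ D).

(** Restriction to h forgets the multiples of the sum of all eps_i; the degree tells them apart,
    being n + 1 on that sum. *)
Definition P_degree (e : 'rV[int]_n.+1) : int := \sum_i e 0 i.

Lemma P_degreeD e e' : P_degree (e + e') = P_degree e + P_degree e'.
Proof. by rewrite -big_split; apply: eq_bigr => i _; rewrite mxE. Qed.

Lemma P_degreeN e : P_degree (- e) = - P_degree e.
Proof. by rewrite -sumrN; apply: eq_bigr => i _; rewrite mxE. Qed.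

Lemma P_degree_Peps i : P_degree (Peps i) = 1.
Proof.
rewrite /P_degree (bigD1 i) //= mxE !eqxx big1 // => j /negPf ji.
by rewrite mxE ji.
Qed.

Lemma P_degree_even e : P_rootp false e -> P_degree e = 0.
Proof. by case=> i [j [_ ->]]; rewrite P_degreeD P_degreeN !P_degree_Peps. Qed.

Lemma P_degree_odd e : P_rootp true e -> P_degree e = 2 \/ P_degree e = - 2%:Z.
Proof.
case=> [[i [j ->]]|[i [j [_ ->]]]]; [left|right].
  by rewrite P_degreeD !P_degree_Peps.
by rewrite P_degreeN P_degreeD !P_degree_Peps.
Qed.

Lemma P_degree_root e : root e ->
  [\/ P_degree e = 0, P_degree e = 2 | P_degree e = - 2%:Z].
Proof.
by case=> [/P_degree_even|/P_degree_odd[]];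
  [constructor 1|constructor 2|constructor 3].
Qed.

Lemma Pdiag_coordinate (a : 'rV[K]_n.+1) y i : \sum_i a 0 i = 0 ->
  vsval y = f (Pdiag a) -> eps i y = a 0 i.
Proof. by case: fP => _ _ + a0 ya; apply. Qed.

Lemma coroot_value (e : rlat D) (i j : 'I_n.+1) : i <> j ->
  rval e (Hc (Peps i - Peps j)) = (e 0 i - e 0 j)%:~R :> K.
Proof.
move=> ij; have [/(_ i j ij) HcE _] := hHc.
pose a : 'rV[K]_n.+1 := delta_mx 0 i - delta_mx 0 j.
have aE l : a 0 l = (l == i)%:R - (l == j)%:R by rewrite !mxE.
have sum0 : \sum_l a 0 l = 0.
  rewrite (eq_bigr (fun l => (l == i)%:R * 1 - (l == j)%:R * 1)) => [|l _].
    by rewrite sumrB !sum_delta subrr.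
  by rewrite !mulr1.
rewrite sum_lfunE.
rewrite (eq_bigr (fun l => (l == i)%:R * (e 0 l)%:~R - (l == j)%:R * (e 0 l)%:~R)).
  by rewrite sumrB !sum_delta rmorphB.
by move=> l _; rewrite lfun_mulz (Pdiag_coordinate l sum0 HcE) aE -mulrzr mulrBl.
Qed.

(** The coroots of the even roots show that ga - al has equal coordinates; as its degree is 0, they
    all vanish. *)
Lemma P_restriction_inj (ga al : rlat D) : P_degree ga = P_degree al ->
  (forall j, rval ga (H j) = rval al (H j)) -> ga = al.
Proof.
move=> deg e.
have {e}ey := cartan_lfun_eq hHX e.
have diff i : ga 0 i - al 0 i = ga 0 ord0 - al 0 ord0.
  have [->//|/eqP i0] := eqVneq i ord0.
  have := congr1 (fun mu : 'Hom(_, _) => mu (Hc (Peps i - Peps ord0))) ey.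
  rewrite /= !coroot_value // => /(intr_inj0 charK).
  by move=> /= gal; apply/eqP; rewrite subr_eq addrAC -subr_eq opprK; lia.
have /eqP : P_degree ga - P_degree al = 0 by rewrite deg subrr.
rewrite /P_degree -sumrB (eq_bigr _ (fun i _ => diff i)) sumr_const card_ord.
rewrite mulrn_eq0 /= subr_eq0 => /eqP d0.
by apply/rowP => i; apply/eqP; rewrite -subr_eq0 diff d0 subrr.
Qed.

(** A root ga other than al of the same weight has the other odd degree, which is that of be; so ga
    + be has degree 4 or -4 and is not a root. *)
Lemma P_odd_bracket0 (al be ga : rlat D) : rootp true al -> rootp true be ->
  rootp true ga -> P_degree (al + be) = 0 -> ga != al ->
  (forall j, rval ga (H j) = rval al (H j)) -> {[X ga, X be]} = 0.
Proof.
move=> al_odd be_odd ga_odd deg /eqP gaal e.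
have degD : P_degree ga <> P_degree al by move=> dd; apply/gaal/P_restriction_inj.
have [rga rbe] : root ga /\ root be by split; right.
have gabe : ga <> - be.
  move=> gbe; apply: degD; rewrite gbe P_degreeN; apply/eqP.
  by rewrite eq_sym -addr_eq0 -P_degreeD deg.
case: hHX => _ [_ _ _ /(_ _ _ rga rbe gabe)[+ _ _]]; apply.
move=> /P_degree_root; move: deg degD; rewrite !P_degreeD.
have := P_degree_odd al_odd; have := P_degree_odd be_odd.
have := P_degree_odd ga_odd.
by move=> ? ? ? ? ? []; lia.
Qed.

Lemma P_root_even i j : i <> j -> root (Peps i - Peps j).
Proof. by move=> ij; left; exists i, j. Qed.

Lemma P_coroot_killed (W : zmodType) (a : W) i j :
  (forall x : W, x *+ 2 = 0 -> x = 0) -> i <> j ->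
  annihilates b a (vsval (Hc (Peps i - Peps j))) -> a = 0.
Proof.
move=> W2 ij aH.
have rij := P_root_even ij.
have rji : root (- (Peps i - Peps j)) by rewrite opprB; apply/P_root_even/nesym.
have [z ze az] := annihilates_cartan charK hHX h_even hV hVr hM
  (coroot_integral hHX rij rji) aH rij.
apply: W2; rewrite -[_ *+ 2]/(a *~ 2) (_ : 2 = z) //; apply: (intr_inj0 charK).
rewrite /= -ze coroot_value // !mxE !eqxx /= eq_sym.
by case: eqP ij => // <-.
Qed.

(** Here - al is a root, and the bracket of the two root vectors is, up to sign, the coroot of eps_i
    - eps_j, on which that root takes the value 2. *)
Lemma P_beta_detected (al : rlat D) (i j : 'I_n.+1) : (i < j)%N ->
  al = Peps i + Peps j \/ al = - (Peps i + Peps j) ->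
  exists be, detected H X b al be.
Proof.
move=> ij alE; have inj : i <> j by move=> e; rewrite e ltnn in ij.
have [al_odd nal_odd] : @rootp _ _ _ D true al /\ @rootp _ _ _ D true (- al).
  by case: alE => ->; rewrite ?opprK; split;
    do [by left; exists i, j | by right; exists i, j].
have [ral rnal] : root al /\ root (- al) by split; right.
exists (- al); split=> // [ga ga_odd gaal e|W a W2].
  apply: (P_odd_bracket0 al_odd) => //.
  by rewrite subrr /P_degree big1 // => l _; rewrite mxE.
move=> /(annihilates_coroot hHX ral rnal) aH; apply: (P_coroot_killed W2 inj).
have [_ /(_ _ _ ij)[HcP HcN]] := hHc.
case: alE aH => ->; rewrite ?HcP ?HcN //.
rewrite linearN /= -scaleN1r => aH.
exact: (@annihilates_sign _ _ _ _ _ _ _ true).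
Qed.

Lemma P_eps_sum0 y : \sum_i eps i y = 0 :> K.
Proof.
have [_ /(_ (vsval y))[+ _] _] := fP => /(_ (subvsP y))[a a0 ya].
by rewrite -[RHS]a0; apply: eq_bigr => i _; apply: Pdiag_coordinate.
Qed.

(* The element of h dual to 2 eps_i has coordinates
   2 delta_il - 2 / (n + 1); it has norm 4 n / (n + 1). *)
Lemma P_rform_gamma i : (0 < n)%N ->
  rform (Peps i + Peps i : rlat D) (Peps i + Peps i) <> 0.
Proof.
move=> n0; pose al : rlat D := Peps i + Peps i.
have N0 : n.+1%:R != 0 :> K by rewrite (pcharf0P K).1.
have alE y : rval al y = eps i y + eps i y :> K.
  rewrite /= sum_lfunE (eq_bigr (fun l => (l == i)%:R * (eps i y + eps i y) : K)).
    by rewrite sum_delta.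
  move=> l _; rewrite lfun_mulz !mxE eqxx /=.
  by case: eqP => [->|_]; rewrite ?mulr0z ?mul0r // mulrzDr mulr1z mul1r.
pose a : 'rV[K]_n.+1 := \row_l (2%:R / n.+1%:R * ((l == i)%:R * n.+1%:R - 1)).
have a0 : \sum_l a 0 l = 0.
  under eq_bigr do rewrite mxE; rewrite -mulr_sumr sumrB sum_delta.
  by rewrite sumr_const card_ord subrr mulr0.
have [_ /(_ (f (Pdiag a)))[_ /(_ (ex_intro2 _ _ a a0 erefl)) fa] _] := fP.
pose t : subvs_of h := vsproj h (f (Pdiag a)).
have tE : vsval t = f (Pdiag a) by rewrite vsprojK.
have epst l : eps l t = a 0 l := Pdiag_coordinate l a0 tE.
have t_dual y : hform D t y = rval al y.
  rewrite alE /=.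
  rewrite (eq_bigr (fun l => (l == i)%:R * (2%:R * eps l y) - 2%:R / n.+1%:R * eps l y)).
    by rewrite sumrB sum_delta -mulr_sumr P_eps_sum0 mulr0 subr0 mulr_natl mulr2n.
  move=> l _; rewrite epst mxE mulrBr mulr1 mulrBl; congr (_ - _).
  by rewrite mulrCA divfK // mulrA.
rewrite /rform -/al.
have dualP : forall y, hform D (dual_elt (hform D) (rval al)) y = rval al y.
  exact: (classical_sets.xgetPex (T := subvs_of h) 0
    (ex_intro (fun t => forall y, hform D t y = rval al y) t t_dual)).
rewrite dualP -t_dual.
(* With t' the chosen dual element, (t', t') = al(t') = (t, t') = (t', t) = al(t), so the norm is
   read off the explicit t. *)
have symm y z : hform D y z = hform D z y.
  by apply: eq_bigr => l _; rewrite mulrC.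
rewrite symm dualP alE epst mxE eqxx mul1r; apply/eqP.
have double (x : K) : x != 0 -> x + x != 0.
  by move=> x0; rewrite -mulr2n -mulr_natl mulf_neq0 // (pcharf0P K).1.
apply: double; rewrite !mulf_neq0 ?invr_eq0 ?(pcharf0P K).1 //.
by rewrite -[1]/(1%:R) -natrB // subn1 (pcharf0P K).1 // -lt0n.
Qed.

(** One step down the string has degree -4, so it is neither a root nor 0. *)
Lemma P_gamma_string i j r :
  @string_r _ _ _ D (Peps i + Peps i) (- (Peps i + Peps j)) r -> r = 0%N.
Proof.
case: r => // r [/(_ 1%N isT) + _]; rewrite mulr1n => rt; exfalso.
have deg : P_degree (- (Peps i + Peps j) - (Peps i + Peps i)) = - 4%:Z.
  by rewrite !(P_degreeD, P_degreeN, P_degree_Peps).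
case: rt => [/P_degree_root|e0]; first by rewrite deg => -[].
by move: deg; rewrite e0 /P_degree big1 // => l _; rewrite mxE.
Qed.

(** The bracket with the root vector of -(eps_i + eps_j) is, up to sign, that of eps_i - eps_j; a
    further bracket with the opposite even root vector produces a coroot. *)
Lemma P_gamma_detected i : (0 < n)%N ->
  exists be, detected H X b (Peps i + Peps i : rlat D) be.
Proof.
move=> n0.
have [j ij] : exists j : 'I_n.+1, i <> j.
  have [->|/eqP i0] := eqVneq i ord0; last by exists ord0.
  by exists ord_max => /(congr1 val) /= e; rewrite -e in n0.
pose al : rlat D := Peps i + Peps i; pose be : rlat D := - (Peps i + Peps j).
have al_odd : @rootp _ _ _ D true al by left; exists i, i.
have be_odd : @rootp _ _ _ D true be.
  right; have [ltij|ltji|/val_inj//] := ltngtP i j; first by exists i, j.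
  by exists j, i; rewrite addrC.
have albe : al + be = Peps i - Peps j by rewrite /al /be opprD addrACA subrr add0r.
have [ral rbe] : root al /\ root be by split; right.
exists be; split=> // [ga ga_odd gaal e|W a W2].
  apply: (P_odd_bracket0 al_odd be_odd ga_odd) => //.
  by rewrite albe P_degreeD P_degreeN !P_degree_Peps.
have alNbe : al <> - be.
  rewrite /al /be opprK => /addrI /(congr1 (fun e : 'rV_n.+1 => e 0 i)).
  by rewrite !mxE !eqxx /=; case: eqP.
have rij := P_root_even ij; have rji := P_root_even (nesym ij).
case: (hHX) => _ [_ _ _ /(_ _ _ ral rbe alNbe)[_ + _]].
rewrite albe => /(_ rij (or_introl (@P_rform_gamma i n0)))[r [e [rstr ->]]].
rewrite (P_gamma_string rstr).
(* An exceptional pair has al = eps_j' + eps_i' with distinct indices, which 2 eps_i is not; the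
   structure constant is therefore 1 up to sign. *)
have -> : `[< exceptional al be >] = false.
  apply/negbTE/negP => /asboolP /= [i' [j' [i'j' alE _]]].
  have := congr1 (fun e : 'rV_n.+1 => e 0 i') alE; rewrite !mxE !eqxx /=.
  by case: eqP => [e1|_]; case: eqP => // e2; case: i'j'; rewrite -e1 -e2.
rewrite mulr1 => /annihilates_sign /(annihilates_bracket charK hHX hM rij rji).
rewrite -(opprB (Peps i)) in rji *.
by move=> /(annihilates_coroot hHX rij rji) /P_coroot_killed; apply.
Qed.

Lemma P_detected (al : rlat D) : (0 < n)%N -> rootp true al ->
  exists be, detected H X b al be.
Proof.
move=> n0 [[i [j ->]]|[i [j [ij ->]]]]; last first.
  by apply: (P_beta_detected ij); right.
have [ij|ji|/val_inj ->] := ltngtP i j; last exact: P_gamma_detected.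
  by apply: (P_beta_detected ij); left.
by rewrite addrC; apply: (P_beta_detected ji); left.
Qed.

End TypeP.

(* The sole nonzero block of an element of P(0) is the upper right one, hence
   all brackets vanish. *)
Lemma typeP0_abelian (K : fieldType) (g : lieSuperalgebra K)
    (f : {linear 'M[K]_(1 + 1) -> g}) : [pchar K] =i pred0 ->
  @P_iso K g 0 f -> forall x y : g, lbr x y = 0.
Proof.
move=> charK [f_part f_br f_surj f_ker] x y.
have [x' Sx <-] := f_surj x; have [y' Sy <-] := f_surj y.
have S_shape (z : 'M[K]_(1 + 1)) : Pset z ->
    exists c, z = block_mx 0 c 0 0.
  case=> tr dr ur dl; exists (ursubmx z).
  have ul0 : ulsubmx z = 0.
    by apply/matrixP => i j; rewrite !ord1 [RHS]mxE -tr /mxtrace big_ord1.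
  rewrite -[LHS]submxK ul0 dr ul0 trmx0 oppr0; congr block_mx.
  have two0 : 2%:R != 0 :> K by rewrite (pcharf0P K).1.
  apply/matrixP => i j; rewrite !ord1 mxE; apply: (mulfI two0).
  have := congr1 (fun M : 'M_1 => M 0 0) dl; rewrite !mxE mulr0 => e.
  by rewrite mulr_natl mulr2n {1}e addNr.
have S_odd (z : 'M[K]_(1 + 1)) : Pset z -> gl_hom true z.
  by move=> /S_shape[c ->]; rewrite /gl_hom block_mxKul block_mxKdr.
rewrite -(f_br true true _ _ Sx Sy (S_odd _ Sx) (S_odd _ Sy)).
have [c ->] := S_shape _ Sx; have [e ->] := S_shape _ Sy.
rewrite !mulmx_block !mulmx0 !mul0mx !addr0.
by rewrite [X in f X](_ : _ = 0) ?linear0 // block_mx0 scaler0 subr0.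
Qed.

Lemma odd_root_detected (K : fieldType) (charK : [pchar K] =i pred0)
    (g : lieSuperalgebra K) (nonabelian : exists x y : g, lbr x y <> 0)
    (h : {vspace g}) (h_even : (h <= lpart g false)%VS)
    (D : rootDatum h) (hD : root_datum_of_type D)
    (neg : rlat D -> Prop) (Hc : rlat D -> subvs_of h) (hHc : coroots Hc)
    (H : 'I_(\dim h) -> subvs_of h) (X : rlat D -> g)
    (hHX : chevalley_basis neg Hc H X)
    (V : gmodule g) (hV : faithful_module V) (hVr : rational_module V H)
    (d : nat) (b : d.-tuple V) (p : 'I_d -> bool)
    (hM : admissible_basis H X b p) (al : rlat D) :
  rootp true al -> exists be, detected H X b al be.
Proof.
case: hD neg Hc hHc X hHX hM al => [kap _ kapP|n f eps fP] neg Hc hHc X hHX hM al.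
  exact: (nonP_detected charK kapP hHc hHX h_even hV hVr hM).
apply: (P_detected charK fP hHc hHX h_even hV hVr hM).
(* Detecting 2 eps_i takes a second index, so n = 0 is ruled out: P(0) is Abelian. *)
case: n f eps fP neg Hc hHc X hHX hM al => // f eps [fP _ _] _ _ _ _ _ _ _.
by have [x [y []]] := nonabelian; apply: (typeP0_abelian charK fP).
Qed.

(** * Representability of the odd functors *)

Section OddFunctors.
Variables (K : fieldType) (charK : [pchar K] =i pred0)
  (g : lieSuperalgebra K) (h : {vspace g}) (h_even : (h <= lpart g false)%VS)
  (D : rootDatum h) (neg : rlat D -> Prop) (Hc : rlat D -> subvs_of h)
  (H : 'I_(\dim h) -> subvs_of h) (X : rlat D -> g)
  (hHX : chevalley_basis neg Hc H X)
  (V : gmodule g) (hV : faithful_module V) (hVr : rational_module V H)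
  (d : nat) (b : d.-tuple V) (p : 'I_d -> bool)
  (hM : admissible_basis H X b p)
  (k : comNzRingType) (hk : good_base k) (s : seq (rlat D)).
Hypotheses (s_uniq : uniq s) (s_odd : forall al, al \in s -> rootp true al)
  (s_det : forall al, al \in s -> exists be, detected H X b al be).

Lemma G1_odd_space : [/\ represented_by_odd_space hk (G1 k X b p s) (size s),
  is_sheaf (G1 k X b p s) & equals_sheafification (G1 k X b p s)].
Proof.
have free (A : salg k) : integrally_free A [seq root_mx X b al | al <- s].
  apply: (root_mx_free charK hHX h_even hV hVr hM) => //.
    exact: salg_torsion2.
  by move=> al als; split; [apply: s_odd | apply: s_det].
have odd i : odd_mx p (tnth (in_tuple [seq root_mx X b al | al <- s]) i).
  have /mapP[al als ->] := mem_tnth i (in_tuple [seq root_mx X b al | al <- s]).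
  exact/(root_mx_odd charK hHX hM)/s_odd.
have sh : is_sheaf (G1 k X b p s) := odd_functor_sheaf odd free.
split=> //; last exact: sheaf_equals_sheafification.
by have := odd_functor_represented odd free hk; rewrite size_map.
Qed.
End OddFunctors.

Theorem proposition5p3p12
  (K : closedFieldType) (hK : [pchar K] =i pred0)
  (g : lieSuperalgebra K) (hg : standing_assumption g)
  (h : {vspace g}) (hh : cartan_of_even h)
  (D : rootDatum h) (hD : root_datum_of_type D)
  (Pi pos neg : rlat D -> Prop) (hPi : distinguished_system Pi pos neg)
  (Hc : rlat D -> subvs_of h) (hHc : coroots Hc)
  (H : 'I_(\dim h) -> subvs_of h) (X : rlat D -> g)
  (hHX : chevalley_basis neg Hc H X)
  (V : gmodule g) (hV : faithful_module V) (hVr : rational_module V H)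
  (d : nat) (b : d.-tuple V) (p : 'I_d -> bool)
  (hM : admissible_basis H X b p)
  (k : comNzRingType) (hk : good_base k)
  (sp sm s : seq (rlat D))
  (hsp : enumerates sp (fun al => pos al /\ rootp true al))
  (hsm : enumerates sm (fun al => neg al /\ rootp true al))
  (hs : enumerates s (rootp true)) :
  let Gp := G1 k X b p sp in
  let Gm := G1 k X b p sm in
  let G := G1 k X b p s in
  [/\ represented_by_odd_space hk Gp (size sp), is_sheaf Gp
    & equals_sheafification Gp] /\
  [/\ represented_by_odd_space hk Gm (size sm), is_sheaf Gm
    & equals_sheafification Gm] /\
  [/\ represented_by_odd_space hk G (size s), is_sheaf G
    & equals_sheafification G] /\
  size s = (size sp + size sm)%N.
Proof.
move=> Gp Gm G.
have h_even : (h <= lpart g false)%VS by case: hh.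
have nonabelian : exists x y : g, lbr x y <> 0 by case: hg => -[].
have det := odd_root_detected hK nonabelian h_even hD hHc hHX hV hVr hM.
have main (t : seq (rlat D)) : uniq t -> (forall al, al \in t -> rootp true al) ->
    [/\ represented_by_odd_space hk (G1 k X b p t) (size t),
        is_sheaf (G1 k X b p t) & equals_sheafification (G1 k X b p t)].
  move=> t_uniq t_odd.
  apply: (G1_odd_space hK h_even hHX hV hVr hM) => // al /t_odd.
  exact: det.
have [sp_uniq spE] := hsp; have [sm_uniq smE] := hsm; have [s_uniq sE] := hs.
split; first by apply: main => // al /spE[].
split; first by apply: main => // al /smE[].
split; first by apply: main => // al /sE.
have [[rootE pos_neg _ _] _] := hPi.
(* The positive and negative odd roots are disjoint and exhaust the odd roots, so the two lists
   together are a permutation of [s]. *)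
rewrite -size_cat; apply/perm_size/uniq_perm => //.
  rewrite cat_uniq sp_uniq sm_uniq andbT /=; apply/hasPn => al /smE[al_neg _].
  by apply/negP => /spE[/pos_neg].
move=> al; rewrite mem_cat; apply/idP/orP => [/sE al_odd|].
  by case: (rootE al).1 => [|al_pos|al_neg]; [right|left; apply/spE|right; apply/smE].
by case=> [/spE[_]|/smE[_]] /sE.
Qed.
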